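(* Let $p>1$, let $\Omega\subset\mathbb{R}^N$ be a bounded domain with $N>p$, and put $p^*=\frac{pN}{N-p}$. If $r>p^*\ge\varpi>q\ge1$ and $\lambda>0$, then for each of the functionals $$\mathcal{J}(u)=\frac1r\|u\|_W^r+\frac1q\|u\|_q^q-\frac\lambda\varpi\|u\|_\varpi^\varpi,\qquad \mathcal{J}^+(u)=\frac1r\|u\|_W^r+\frac1q\|u^+\|_q^q-\frac\lambda\varpi\|u^+\|_\varpi^\varpi$$ on $W_0^{1,p}(\Omega)$, the origin is a local minimum with respect to the $L^\infty$ norm (and with respect to the $\mathcal{C}^1$ norm), but not with respect to the $W_0^{1,p}$ norm.
   Context: $\|u\|_W=\left(\int_\Omega|\nabla u|^p\right)^{1/p}$ is the norm of $W_0^{1,p}(\Omega)$, $\|\cdot\|_s$ is the $L^s(\Omega)$ norm, $u^+=\max\{u,0\}$. The origin is a local minimum for a functional $J$ with respect to a norm $\|\cdot\|_X$ if there is $\rho>0$ such that $J(u)\ge J(0)$ for all $u\in W_0^{1,p}(\Omega)\cap X$ with $\|u\|_X<\rho$, where $X=L^\infty(\Omega)$, $X=\mathcal{C}^1(\overline\Omega)$, or $X=W_0^{1,p}(\Omega)$, respectively. *)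

(* Defs.v *)
From HB Require Import structures.
From mathcomp Require Import all_boot all_order all_algebra.
From mathcomp Require Import all_classical all_reals all_analysis.

Set Implicit Arguments.
Unset Strict Implicit.
Unset Printing Implicit Defensive.

Import Order.TTheory GRing.Theory Num.Theory.
Import numFieldNormedType.Exports.

Local Open Scope classical_set_scope.
Local Open Scope ring_scope.

(* The product sigma-algebra on R^n (on n-tuples, the library's choice);
   it is the Borel sigma-algebra of the usual topology of 'rV[R]_n. *)
Definition rV_display : measure_display. Proof. exact. Qed.

Section measurable_rV.
Context {R : realType} (n : nat).

Definition rV_coord (i : 'I_n) (x : 'rV[R]_n) : R := x ord0 i.

Let rV_set0 : g_sigma_preimage rV_coord set0.
Proof. exact: sigma_algebra0. Qed.

Let rV_setC A : g_sigma_preimage rV_coord A -> g_sigma_preimage rV_coord (~` A).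
Proof. exact: sigma_algebraC. Qed.

Let rV_bigcup (F : _^nat) : (forall i, g_sigma_preimage rV_coord (F i)) ->
  g_sigma_preimage rV_coord (\bigcup_i (F i)).
Proof. exact: sigma_algebra_bigcup. Qed.

HB.instance Definition _ := @isMeasurable.Build rV_display
  'rV[R]_n (g_sigma_preimage rV_coord) rV_set0 rV_setC rV_bigcup.

End measurable_rV.

Section rV_cons.
Context {R : realType} (n : nat).

Definition rV_cons (x : measurableTypeR R * 'rV[R]_n) : 'rV[R]_n.+1 :=
  \row_i oapp (fun j : 'I_n => x.2 ord0 j) x.1 (unlift ord0 i).

Lemma measurable_rV_coord (i : 'I_n) :
  measurable_fun [set: 'rV[R]_n] (@rV_coord R n i).
Proof.
move=> _ Y mY; rewrite setTI; apply: sub_sigma_algebra => /=.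
rewrite -bigcup_seq/=; exists i => /=; first by rewrite mem_index_enum.
by exists Y => //; rewrite setTI.
Qed.

End rV_cons.

Lemma measurable_fun_rVP (R : realType) n d (T : measurableType d)
    (f : T -> 'rV[R]_n) :
  (forall i, measurable_fun [set: T] (fun x => f x ord0 i)) ->
  measurable_fun [set: T] f.
Proof.
move=> mf.
suff : g_sigma_preimage (fun i => @rV_coord R n i \o f) `<=` measurable.
  rewrite g_sigma_preimage_comp => prefS _ A mA.
  by apply: prefS; exists A.
apply: smallest_sub; first exact: sigma_algebra_measurable.
rewrite -bigcup_seq => A [/= i _ [B mB <-]].
exact: mf.
Qed.

Lemma measurable_rV_cons (R : realType) n :
  measurable_fun [set: measurableTypeR R * 'rV[R]_n] (@rV_cons R n).
Proof.
apply: measurable_fun_rVP => i.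
rewrite (_ : (fun _ => _) = fun x : measurableTypeR R * 'rV[R]_n =>
   oapp (fun j : 'I_n => x.2 ord0 j) x.1 (unlift ord0 i)); last first.
  by apply/funext => x; rewrite mxE.
case: (unlift ord0 i) => [j|] /=; last exact: measurable_fst.
exact: (measurableT_comp (measurable_rV_coord j) measurable_snd).
Qed.

HB.instance Definition _ (R : realType) n :=
  isMeasurableFun.Build _ _ _ _ (@rV_cons R n) (@measurable_rV_cons R n).

Section lebesgue_rV_step.
Context {R : realType} (n : nat).
Variable m : {sigma_finite_measure set 'rV[R]_n -> \bar R}.

Definition lebesgue_rV_step : set 'rV[R]_n.+1 -> \bar R :=
  pushforward (@lebesgue_measure R \x m)%E (@rV_cons R n).

Let step0 : lebesgue_rV_step set0 = 0%E.
Proof. exact: measure0. Qed.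

Let step_ge0 A : (0 <= lebesgue_rV_step A)%E.
Proof. exact: measure_ge0. Qed.

Let step_sigma_additive : semi_sigma_additive lebesgue_rV_step.
Proof. exact: measure_semi_sigma_additive. Qed.

HB.instance Definition _ := isMeasure.Build _ _ _ lebesgue_rV_step
  step0 step_ge0 step_sigma_additive.

Let step_sigma_finite : sigma_finite setT lebesgue_rV_step.
Proof.
have /sigma_finiteP[F [TF ndF Foo]] := sigma_finiteT (@lebesgue_measure R).
have /sigma_finiteP[G [TG ndG Goo]] := sigma_finiteT m.
pose h (y : 'rV[R]_n.+1) : measurableTypeR R * 'rV[R]_n :=
  (y ord0 ord0, \row_j y ord0 (lift ord0 j)).
have hK x : h (rV_cons x) = x.
  case: x => a v; rewrite /h; congr pair; first by rewrite mxE unlift_none.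
  by apply/rowP => j; rewrite !mxE liftK.
have mh : measurable_fun setT h.
  apply/measurable_fun_pairP; split; first exact: measurable_rV_coord.
  apply: measurable_fun_rVP => i; rewrite (_ : (fun _ => _) =
      @rV_coord R n.+1 (lift ord0 i)); first exact: measurable_rV_coord.
  by apply/funext => x; rewrite mxE.
exists (fun k => h @^-1` (F k `*` G k)).
  apply/seteqP; split => // y _.
  have : setT (h y).1 by []. rewrite TF => -[i _ Fi].
  have : setT (h y).2 by []. rewrite TG => -[j _ Gj].
  exists (maxn i j) => //; split.
    by move: Fi; exact/subsetPset/ndF/leq_maxl.
  by move: Gj; exact/subsetPset/ndG/leq_maxr.
move=> k; have [mF oF] := Foo k; have [mG oG] := Goo k; split.
  by rewrite -[X in measurable X]setTI; apply: mh => //; exact: measurableX.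
rewrite /= /lebesgue_rV_step /pushforward (_ : _ @^-1` _ = F k `*` G k).
  by rewrite product_measure1E// lte_mul_pinfty// ge0_fin_numE.
by rewrite -comp_preimage (_ : h \o _ = id) ?preimage_id//; exact/funext.
Qed.

HB.instance Definition _ := Measure_isSigmaFinite.Build _ _ _
  lebesgue_rV_step step_sigma_finite.

End lebesgue_rV_step.

(* Lebesgue measure on R^n as an iterated product measure; on R^0 it is the
   unit mass. *)
Fixpoint lebesgue_rV (R : realType) (n : nat) :
    {sigma_finite_measure set 'rV[R]_n -> \bar R} :=
  if n is k.+1 then lebesgue_rV_step (lebesgue_rV R k) else \d_ (0 : 'rV[R]_0).

Lemma lebesgue_rV_box (R : realType) n (A : 'I_n -> set (measurableTypeR R)) :
  (forall i, measurable (A i)) ->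
  lebesgue_rV R n [set x | forall i, A i (x ord0 i)] =
  (\prod_(i < n) lebesgue_measure (A i))%E.
Proof.
elim: n A => [|n IH] A mA.
  by rewrite big_ord0 /= diracE mem_set// => -[].
rewrite big_ord_recl /= /lebesgue_rV_step /pushforward.
rewrite (_ : _ @^-1` _ = A ord0 `*`
    [set x : 'rV[R]_n | forall i, A (lift ord0 i) (x ord0 i)]); last first.
  apply/seteqP; split => -[a v] /=.
    move=> H; split; first by have := H ord0; rewrite mxE unlift_none.
    by move=> i; have := H (lift ord0 i); rewrite mxE liftK.
  move=> [H0 H] i; rewrite mxE.
  by case: unliftP => [j ->|->] //=.
rewrite product_measure1E//.
  by congr (_ * _)%E; exact: (IH (fun i => A (lift ord0 i))).
rewrite (_ : [set _ | _] = \big[setI/setT]_(i < n)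
   (@rV_coord R n i @^-1` A (lift ord0 i))).
  apply: bigsetI_measurable => i _.
  by rewrite -[X in measurable X]setTI; apply: (measurable_rV_coord i) => //; exact: mA.
rewrite -bigcap_seq; apply/seteqP; split => x /= H i; first by move=> _; apply: H.
by apply: (H i); rewrite /= mem_index_enum.
Qed.

Section sobolev.
Context {R : realType} {N : nat}.
Local Notation E := 'rV[R]_N.
Local Notation mu := (lebesgue_rV R N).
Implicit Types (Omega : set E) (p : R) (s : \bar R) (u f phi : E -> R).

(* the library norm of 'rV[R]_N is the sup norm *)
Definition euclidean_norm (v : E) : R := Num.sqrt (\sum_i v ord0 i ^+ 2).

Definition partial (i : 'I_N) f : E -> R := 'D_(delta_mx ord0 i) f.

Definition gradient f (x : E) : E := \row_i partial i f x.

Fixpoint Ck (k : nat) f : Prop :=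
  if k is k'.+1 then
    continuous f /\
    forall i, (forall x, derivable f x (delta_mx ord0 i)) /\ Ck k' (partial i f)
  else continuous f.

Definition test_function Omega phi : Prop :=
  [/\ forall k, Ck k phi, compact (closure [set x | phi x != 0]) &
      closure [set x | phi x != 0] `<=` Omega].

(* Functions on Omega are represented by functions on R^N whose values outside
   Omega are irrelevant; [f \_ Omega] is f on Omega and 0 elsewhere. *)
Definition in_Ls Omega s f : Prop := f \_ Omega \in Lfun mu s.

Definition Ls_norm Omega s f : \bar R := 'N[mu]_s[EFin \o (f \_ Omega)]%E.

Definition loc_integrable Omega f : Prop :=
  measurable_fun Omega f /\
  forall K, compact K -> K `<=` Omega -> mu.-integrable K (EFin \o f).

Definition is_weak_gradient Omega u (g : E -> E) : Prop :=
  [/\ loc_integrable Omega u,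
      forall i, loc_integrable Omega (fun x => g x ord0 i) &
      forall phi i, test_function Omega phi ->
        \int[mu]_(x in Omega) (u x * partial i phi x) =
        - \int[mu]_(x in Omega) (g x ord0 i * phi x)].

(* Some weak gradient of u if there is one; it is unique almost everywhere in
   Omega when Omega is open. *)
Definition weak_gradient Omega u : E -> E :=
  xget (fun=> 0) [set g | is_weak_gradient Omega u g].

Definition W1p Omega p : set (E -> R) := [set u |
  [/\ in_Ls Omega p%:E u, is_weak_gradient Omega u (weak_gradient Omega u) &
      forall i, in_Ls Omega p%:E (fun x => weak_gradient Omega u x ord0 i)]].

(* the closure of the test functions in W^{1,p}(Omega) *)
Definition W1p0 Omega p : set (E -> R) := [set u | W1p Omega p u /\
  exists phi : nat -> E -> R,
    [/\ forall n, test_function Omega (phi n),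
        Ls_norm Omega p%:E (phi n \- u) @[n --> \oo] --> 0%E &
        forall i, Ls_norm Omega p%:E (fun x => partial i (phi n) x -
                    weak_gradient Omega u x ord0 i) @[n --> \oo] --> 0%E]].

Definition W_norm Omega p u : \bar R :=
  Ls_norm Omega p%:E (fun x => euclidean_norm (weak_gradient Omega u x)).

Definition extends_to_closure Omega f : Prop :=
  exists g : E -> R,
    {within closure Omega, continuous g} /\ forall x, Omega x -> g x = f x.

Definition C1_closure Omega : set (E -> R) := [set u |
  [/\ forall x i, Omega x -> derivable u x (delta_mx ord0 i),
      extends_to_closure Omega u &
      forall i, extends_to_closure Omega (partial i u)]].

(* By continuity the suprema over Omega are those over its closure. *)
Definition C1_norm Omega u : \bar R :=
  (ereal_sup [set (`|u x|)%:E | x in Omega] +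
   ereal_sup [set (euclidean_norm (gradient u x))%:E | x in Omega])%E.

Definition local_min_origin (W X : set (E -> R)) (normX : (E -> R) -> \bar R)
    (J : (E -> R) -> \bar R) : Prop :=
  exists2 rho : R, 0 < rho &
    forall u, W u -> X u -> (normX u < rho%:E)%E -> (J (cst 0%R) <= J u)%E.

(* The functionals are extended-real valued so that they make sense for every
   function; for the exponents at hand the Sobolev embedding makes every term
   finite on W_0^{1,p}(Omega). *)
Definition functional Omega (p q varpi r lambda : R) u : \bar R :=
  ((r^-1)%:E * W_norm Omega p u `^ r + (q^-1)%:E * Ls_norm Omega q%:E u `^ q
   - (lambda / varpi)%:E * Ls_norm Omega varpi%:E u `^ varpi)%E.

Definition functional_pos Omega (p q varpi r lambda : R) u : \bar R :=
  ((r^-1)%:E * W_norm Omega p u `^ r +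
   (q^-1)%:E * Ls_norm Omega q%:E (u^\+)%R `^ q
   - (lambda / varpi)%:E * Ls_norm Omega varpi%:E (u^\+)%R `^ varpi)%E.

Definition local_min_Linfty Omega p (J : (E -> R) -> \bar R) : Prop :=
  local_min_origin (W1p0 Omega p) (in_Ls Omega +oo%E) (Ls_norm Omega +oo%E) J.

Definition local_min_C1 Omega p (J : (E -> R) -> \bar R) : Prop :=
  local_min_origin (W1p0 Omega p) (C1_closure Omega) (C1_norm Omega) J.

Definition local_min_W1p0 Omega p (J : (E -> R) -> \bar R) : Prop :=
  local_min_origin (W1p0 Omega p) (W1p0 Omega p) (W_norm Omega p) J.

End sobolev.

Definition bounded_domain (R : realType) (N : nat) (Omega : set 'rV[R]_N) :
    Prop :=
  [/\ Omega !=set0, open Omega, connected Omega & bounded_set Omega].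

(* Main.v *)
Require Import Defs.
From HB Require Import structures.
From mathcomp Require Import all_boot all_order all_algebra.
From mathcomp Require Import all_classical all_reals all_analysis.
From mathcomp Require Import measurable_realfun ess_sup_inf ring lra.

(** Both functionals have the form (leading gradient term) + (1/q) int |v|^q
    - (lambda/varpi) int |v|^varpi, with v = u or v = u^+.

    If |v| <= rho almost everywhere, where rho^(varpi - q) = varpi / (lambda q),
    then (lambda/varpi) |v|^varpi <= (1/q) |v|^q pointwise, because varpi > q.
    Hence the functionals are nonnegative on functions with a small uniform bound
    ([lower_order_dominates]), and a small L^oo or C^1 norm gives such a bound.
    Their value at the origin is 0, so the origin is a local minimum in these
    two senses.

    In the Sobolev norm there are negative values arbitrarily close to the
    origin ([exists_negative_bubble]).  A smooth bump of height M on a cube of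
    size e has L^q and L^varpi terms of orders M^q e^N and M^varpi e^N, gradient
    norm of order M e^(N/p - 1), and leading term of order (M e^(N/p - 1))^r.
    Fix M so large that the L^varpi term is at least twice the L^q term and
    let e tend to 0: since r exceeds p N / (N - p), the exponent (N/p - 1) r
    exceeds N and the leading term becomes negligible, while N > p forces the
    norm to 0.

    The Sobolev norm is defined from an arbitrarily chosen weak gradient, so the
    remaining work is to evaluate it on the zero function and on a bump.  It relies
    on two facts about Lebesgue measure on R^N as an iterated product: the
    integral of a partial derivative of a compactly supported C^1 function
    vanishes ([integral_partial_eq0]), so that a test function has its classical
    gradient as a weak gradient; and a locally integrable function that
    annihilates all test functions vanishes almost everywhere
    ([ae_eq0_of_test_function]), so that weak gradients are unique.  The latter
    uses smooth bumps converging to indicators of boxes, built from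
    exp(-1/t). *)

Import Order.TTheory GRing.Theory Num.Theory.
Import numFieldNormedType.Exports.

Local Open Scope classical_set_scope.
Local Open Scope ring_scope.
Set Implicit Arguments.
Unset Strict Implicit.
Unset Printing Implicit Defensive.

(** * A flat exponential and smooth functions of several variables *)

Section flat.
Context {R : realType}.
Implicit Types (P : {poly R}) (t : R).

(** The polynomial factor makes this family closed under differentiation, so it
    contains all the derivatives of the function exp(-1/t), extended by zero. *)
Definition flat P t : R := if 0 < t then P.[t^-1] * expR (- t^-1) else 0.

Lemma flat_gt0 P t : 0 < t -> flat P t = P.[t^-1] * expR (- t^-1).
Proof. by rewrite /flat => ->. Qed.

Lemma flat_le0 P t : t <= 0 -> flat P t = 0.
Proof. by rewrite /flat leNgt => /negbTE ->. Qed.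

Lemma exprn_expRN_le n (s : R) : 0 <= s -> s ^+ n * expR (- s) <= n`!%:R.
Proof.
move=> s0; rewrite expRN ler_pdivrMr ?expR_gt0//.
case: n => [|n]; first by rewrite expr0 fact0 mul1r (le_trans _ (expR_ge1Dx s))// lerDl.
have := expR_ge1Dxn n s0.
have f0 : 0 < (n.+1)`!%:R :> R by rewrite ltr0n fact_gt0.
rewrite -(ler_pM2l f0); apply: le_trans.
by rewrite mulrDr mulr1 [X in _ + X]mulrC divfK ?gt_eqF// lerDr ltW.
Qed.

(** A quadratic bound is what makes the difference quotient at 0 tend to 0.
    With s = 1/t each monomial s^i exp(-s) is at most (i+2)! / s^2. *)
Lemma flat_bound P : exists2 C, 0 <= C & forall t, `|flat P t| <= C * t ^+ 2.
Proof.
exists (\sum_(i < size P) `|P`_i| * (i.+2)`!%:R).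
  by apply: sumr_ge0 => i _; rewrite mulr_ge0.
move=> t; have [t0|t0] := leP t 0.
  rewrite flat_le0// normr0 mulr_ge0 ?sqr_ge0//.
  by apply: sumr_ge0 => i _; rewrite mulr_ge0.
rewrite flat_gt0// horner_coef mulr_suml (le_trans (ler_norm_sum _ _ _))//.
rewrite mulr_suml; apply: ler_sum => i _; rewrite !normrM -!mulrA ler_wpM2l//.
rewrite [`|expR _|]ger0_norm ?expR_ge0// ger0_norm; last first.
  by rewrite exprn_ge0 ?invr_ge0 ?ltW.
have := @exprn_expRN_le i.+2 t^-1; rewrite invr_ge0 ltW// => /(_ isT) le.
have -> : t^-1 ^+ i * expR (- t^-1) = t^-1 ^+ i.+2 * expR (- t^-1) * t ^+ 2.
  rewrite -(addn2 i) exprD -!mulrA; congr (_ * _).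
  by field; rewrite gt_eqF.
by rewrite ler_wpM2r// sqr_ge0.
Qed.

(** For t > 0 this is the product rule; at 0 the difference quotient tends to 0
    by [flat_bound]. *)
Lemma is_derive_flat P t : is_derive t 1 (flat P) (flat ('X^2 * (P - P^`())) t).
Proof.
have [t0|t0|->] := ltgtP t 0.
- rewrite flat_le0 ?ltW//.
  apply: (@near_eq_is_derive R R R (cst 0)).
  by near=> y; rewrite flat_le0// ltW//; near: y; exact: lt_nbhsl.
- rewrite flat_gt0//.
  apply: (@near_eq_is_derive R R R (fun y => P.[y^-1] * expR (- y^-1))).
    by near=> y; rewrite flat_gt0//; near: y; exact: lt_nbhsr.
  have dV : is_derive t 1 (fun y : R => y^-1) (- t ^- 2).
    apply: is_derive_eq; first by apply: (@is_deriveV _ id t 1 1); rewrite gt_eqF.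
    by rewrite [LHS]mulr1.
  have dP : is_derive t 1 (fun y : R => P.[y^-1]) (P^`().[t^-1] * - t ^- 2).
    exact: (@is_derive1_comp _ (horner P) (fun y => y^-1)).
  have dE : is_derive t 1 (fun y : R => expR (- y^-1)) (expR (- t^-1) * t ^- 2).
    have dN : is_derive t 1 (fun y : R => - y^-1) (t ^- 2).
      by rewrite -[X in is_derive _ _ _ X]opprK; exact: is_deriveN dV.
    exact: (@is_derive1_comp _ expR (fun y => - y^-1)).
  have dPE := is_deriveM dP dE.
  apply: (is_derive_eq dPE).
  rewrite -[LHS]/(P.[t^-1] * (expR (- t^-1) / t ^+ 2) +
    expR (- t^-1) * (P^`().[t^-1] * - t ^- 2))
    hornerM hornerXn hornerD hornerN -exprVn; ring.
- rewrite flat_le0//; have [C C0 PC] := flat_bound P.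
  have H : (fun h : R => h^-1 *: ((flat P \o shift 0) (h *: 1) - flat P 0)) @ 0^' --> 0.
    apply/cvgr0Pnorm_le => /= e e0.
    have C1 : 0 < C + 1 by rewrite ltr_wpDl.
    near=> h; rewrite /= addr0 [_%:A]mulr1 (flat_le0 P (lexx 0)) subr0 normrM.
    have h0 : h != 0 by near: h; exact: nbhs_dnbhs_neq.
    rewrite normfV ler_pdivrMl ?normr_gt0// (le_trans (PC h))//.
    rewrite -[h ^+ 2]real_normK ?num_real// expr2 mulrCA ler_wpM2l//.
    rewrite (@le_trans _ _ ((C + 1) * `|h|))// ?ler_wpM2r ?lerDl//.
    rewrite -ler_pdivlMl//; near: h; apply: dnbhs0_le.
    by rewrite mulr_gt0// invr_gt0.
  apply: DeriveDef; first by apply/cvg_ex; exists 0.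
  exact: cvg_lim.
Unshelve. all: by end_near.
Qed.

End flat.

Section Ck.
Context {R : realType} {N : nat}.
Local Notation E := 'rV[R]_N.
Implicit Types f g : E -> R.

Lemma continuous_rV_coord (i : 'I_N) : continuous (fun x : E => x ord0 i).
Proof. exact: coord_continuous. Qed.

(** Along a basis vector the difference quotient of G(x_i) is that of G, or
    identically zero, so no chain rule between normed spaces is involved. *)
Lemma is_derive_rV_coord (G : R -> R) (i j : 'I_N) (x : E) dG :
  is_derive (x ord0 i) 1 G dG ->
  is_derive x (delta_mx ord0 j) (fun y : E => G (y ord0 i))
    (if i == j then dG else 0).
Proof.
move=> [dG1 dG2].
have H : (fun h : R => h^-1 *: (((fun y : E => G (y ord0 i)) \o shift x)
      (h *: delta_mx ord0 j) - G (x ord0 i))) =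
    if i == j then (fun h : R => h^-1 *: ((G \o shift (x ord0 i)) (h *: 1) - G (x ord0 i)))
    else cst 0.
  case: eqVneq => [<-|ij]; apply/funext => h /=; rewrite !mxE !eqxx/=.
    by [].
  by rewrite (negbTE ij) mulr0 add0r subrr scaler0.
split; rewrite /derivable /derive H; case: ifP => // _; first exact: is_cvg_cst.
exact: lim_cst.
Qed.

Lemma CkS k f : Ck k.+1 f -> Ck k f.
Proof.
elim: k f => [|k IH] f; first by case.
move=> /= [cf H]; split => // i; have [df cdf] := H i; split => //.
exact: IH.
Qed.

Lemma CkD k f g : Ck k f -> Ck k g -> Ck k (f \+ g).
Proof.
elim: k f g => [|k IH] f g /=.
  by move=> cf cg x; exact: (continuousD (cf x) (cg x)).
move=> [cf Hf] [cg Hg]; split; first by move=> x; exact: (continuousD (cf x) (cg x)).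
move=> i; have [df Cf] := Hf i; have [dg Cg] := Hg i; split.
  by move=> x; apply: derivableD.
rewrite (_ : partial i _ = partial i f \+ partial i g); first exact: IH.
by apply/funext => x; rewrite /partial deriveD.
Qed.

Lemma partialM i f g x : derivable f x (delta_mx ord0 i) ->
  derivable g x (delta_mx ord0 i) ->
  partial i (f \* g) x = f x * partial i g x + g x * partial i f x.
Proof. by move=> df dg; rewrite /partial deriveM. Qed.

Lemma CkM k f g : Ck k f -> Ck k g -> Ck k (f \* g).
Proof.
elim: k f g => [|k IH] f g /=.
  by move=> cf cg x; exact: (continuousM (cf x) (cg x)).
move=> Cf Cg; have /= CSf := CkS Cf; have /= CSg := CkS Cg.
move: Cf Cg => [cf Hf] [cg Hg]; split; first by move=> x; exact: (continuousM (cf x) (cg x)).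
move=> i; have [df Cf] := Hf i; have [dg Cg] := Hg i; split.
  by move=> x; apply: derivableM.
rewrite (_ : partial i _ = (f \* partial i g) \+ (g \* partial i f)).
  by apply: CkD; apply: IH => //.
by apply/funext => x; rewrite partialM.
Qed.

Lemma partial_cst i c : partial i (cst c : E -> R) = cst 0.
Proof. by apply/funext => x; exact: (@derive_cst R E R). Qed.

Lemma Ck_cst k c : Ck k (cst c : E -> R).
Proof.
elim: k c => [|k IH] c /=; first exact: cst_continuous.
split; first exact: cst_continuous.
by move=> i; split; [move=> x; exact: derivable_cst|rewrite partial_cst].
Qed.

Lemma continuous_flat (P : {poly R}) : continuous (flat P).
Proof.
move=> t; apply: differentiable_continuous; apply/derivable1_diffP.
by have [] := is_derive_flat P t.
Qed.

Lemma is_derive_flat_affine (P : {poly R}) a b (i j : 'I_N) (x : E) :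
  is_derive x (delta_mx ord0 j) (fun y : E => flat P (a * y ord0 i + b))
   (if i == j then a * flat ('X^2 * (P - P^`())) (a * x ord0 i + b) else 0).
Proof.
apply: (@is_derive_rV_coord (fun t => flat P (a * t + b))).
have d1 : is_derive (x ord0 i) 1 (fun t : R => a * t + b) a.
  have da : is_derive (x ord0 i) 1 (fun t : R => a * t) a.
    by apply: (is_derive_eq (@is_deriveZ R R R id a _ 1 1 _)); exact: mulr1.
  by have := is_deriveD da (@is_derive_cst R R R b (x ord0 i) 1); rewrite addr0.
rewrite mulrC.
exact: (@is_derive1_comp R (flat P) (fun t => a * t + b) _ _ _ (is_derive_flat _ _)).
Qed.

(** The constant c is general because differentiation along x_j turns it into
    c * a or 0, which lets the induction on k go through. *)
Lemma Ck_flat k (P : {poly R}) c a b (i : 'I_N) :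
  Ck k (fun x : E => c * flat P (a * x ord0 i + b)).
Proof.
have cc P' c' : continuous (fun x : E => c' * flat P' (a * x ord0 i + b)).
  move=> x; apply: (@cvgM R E (nbhs x) _ (cst c') (fun x : E => flat P' (a * x ord0 i + b))).
    exact: cst_continuous.
  apply: (@continuous_comp _ _ _ (fun x : E => a * x ord0 i + b)); last exact: continuous_flat.
  apply: (@cvgD R R E (nbhs x) _ (fun x : E => a * x ord0 i) (cst b)).
    apply: (@cvgM R E (nbhs x) _ (cst a) (fun x : E => x ord0 i)).
      exact: cst_continuous.
    exact: continuous_rV_coord.
  exact: cst_continuous.
elim: k c P => [|k IH] c P /=; first exact: cc.
split; first exact: cc.
move=> j; have D x : is_derive x (delta_mx ord0 j) (fun y : E => c * flat P (a * y ord0 i + b))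
   ((if i == j then c * a else 0) * flat ('X^2 * (P - P^`())) (a * x ord0 i + b)).
  apply: is_derive_eq.
    exact: (@is_deriveZ _ _ _ _ c _ _ _ (is_derive_flat_affine P a b i j x)).
  by rewrite /GRing.scale/=; case: eqP => _; rewrite ?mulrA// mulr0 mul0r.
split; first by move=> x; case: (D x).
rewrite (_ : partial j _ = fun x => (if i == j then c * a else 0) *
    flat ('X^2 * (P - P^`())) (a * x ord0 i + b)).
  exact: IH.
by apply/funext => x; case: (D x).
Qed.

End Ck.

(** * Boxes, Borel sets and integrable functions *)

Section box.
Context {R : realType} {N : nat}.
Local Notation E := 'rV[R]_N.
Local Notation mu := (lebesgue_rV R N).
Implicit Types a b c x : E.

Definition box a b : set E := [set x | forall i, a ord0 i < x ord0 i < b ord0 i].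
Definition cbox a b : set E := [set x | forall i, a ord0 i <= x ord0 i <= b ord0 i].

Lemma subset_box_cbox a b : box a b `<=` cbox a b.
Proof. by move=> x H i; have /andP[/ltW -> /ltW ->] := H i. Qed.

Lemma measurable_rV_prod (A : 'I_N -> set (measurableTypeR R)) :
  (forall i, measurable (A i)) ->
  measurable [set x : E | forall i, A i (x ord0 i)].
Proof.
move=> mA; rewrite (_ : [set _ | _] = \big[setI/setT]_(i < N)
   (@rV_coord R N i @^-1` A i)).
  apply: bigsetI_measurable => i _.
  by rewrite -[X in measurable X]setTI; apply: (measurable_rV_coord i) => //; exact: mA.
rewrite -bigcap_seq; apply/seteqP; split => x /= H i; first by move=> _; apply: H.
by apply: (H i); rewrite /= mem_index_enum.
Qed.

Lemma boxE a b : box a b =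
  [set x | forall i, `]a ord0 i, b ord0 i[%classic (x ord0 i)].
Proof. by apply/seteqP; split => x H i; have := H i; rewrite /= in_itv. Qed.

Lemma cboxE a b : cbox a b =
  [set x | forall i, `[a ord0 i, b ord0 i]%classic (x ord0 i)].
Proof. by apply/seteqP; split => x H i; have := H i; rewrite /= in_itv. Qed.

Lemma measurable_box a b : measurable (box a b).
Proof.
rewrite boxE; apply: (@measurable_rV_prod (fun i => `]a ord0 i, b ord0 i[%classic)).
by move=> i; exact: measurable_itv.
Qed.

Lemma measurable_cbox a b : measurable (cbox a b).
Proof.
rewrite cboxE; apply: (@measurable_rV_prod (fun i => `[a ord0 i, b ord0 i]%classic)).
by move=> i; exact: measurable_itv.
Qed.

Lemma lebesgue_cube c e : 0 <= e ->
  mu (box (c - const_mx e) (c + const_mx e)) = ((2 * e) ^+ N)%:E.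
Proof.
move=> e0; rewrite boxE.
rewrite (@lebesgue_rV_box R N (fun i =>
  `](c - const_mx e) ord0 i, (c + const_mx e) ord0 i[%classic))//.
rewrite (eq_bigr (fun=> (2 * e)%:E)) => [|i _].
  by rewrite prodEFin prodr_const card_ord.
rewrite lebesgue_measure_itv/= lte_fin !mxE.
case: ltP => [_|]; first by rewrite -EFinB; congr EFin; ring.
by move=> h; congr EFin; lra.
Qed.

Lemma lebesgue_cbox_lty a b : (mu (cbox a b) < +oo)%E.
Proof.
rewrite cboxE (@lebesgue_rV_box R N (fun i => `[a ord0 i, b ord0 i]%classic))//.
rewrite (eq_bigr (fun i => (Num.max 0 (b ord0 i - a ord0 i))%:E)) => [|i _].
  by rewrite prodEFin ltry.
rewrite lebesgue_measure_itv/= lte_fin.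
by case: ltP => [ab|ba]; rewrite ?EFinB; congr EFin; apply/esym;
  [apply/max_idPr|apply/max_idPl]; lra.
Qed.

Lemma compact_cbox a b : compact (cbox a b).
Proof.
rewrite cboxE; apply: (@rV_compact _ _ (fun i => `[a ord0 i, b ord0 i]%classic)).
by move=> i; exact: segment_compact.
Qed.

(** The norm of 'rV is the sup norm, so balls are cubes.  This is how the
    topology of 'rV is related to its product sigma-algebra. *)
Lemma ball_rV x e : 0 < e -> ball x e = box (x - const_mx e) (x + const_mx e).
Proof.
move=> e0; apply/seteqP; split => y.
  move=> [_ H] i; have := H ord0 i; rewrite /ball/= !mxE ltr_norml.
  by move=> /andP[h1 h2]; apply/andP; split; lra.
move=> H; split=> // i j; rewrite ord1; have := H j; rewrite /ball/= !mxE ltr_norml.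
by move=> /andP[h1 h2]; apply/andP; split; lra.
Qed.

Definition rat_rV (q : 'rV[rat]_N) : E := \row_i ratr (q ord0 i).

(** The closed box lies in U as well, because local integrability is a condition
    on compact subsets. *)
Lemma open_rat_box (U : set E) x : open U -> U x ->
  exists q : 'rV[rat]_N * 'rV[rat]_N,
    box (rat_rV q.1) (rat_rV q.2) x /\ cbox (rat_rV q.1) (rat_rV q.2) `<=` U.
Proof.
move=> oU Ux; have /nbhs_ballP[e /= e0 eU] := open_nbhs_nbhs (conj oU Ux).
have /choice[f fP] : forall i, exists q : rat, ratr q \in `](x ord0 i - e), (x ord0 i)[.
  by move=> i; apply: rat_in_itvoo; rewrite ltrBlDr ltrDl.
have /choice[g gP] : forall i, exists q : rat, ratr q \in `](x ord0 i), (x ord0 i + e)[.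
  by move=> i; apply: rat_in_itvoo; rewrite ltrDl.
exists (\row_i f i, \row_i g i); split.
  move=> i; have := fP i; have := gP i; rewrite !mxE !in_itv/=.
  by move=> /andP[-> _] /andP[_ ->].
move=> y ye; apply: eU; rewrite ball_rV// => i.
have := ye i; have := fP i; have := gP i; rewrite !mxE !in_itv/=.
by move=> /andP[_ h1] /andP[h2 _] /andP[h3 h4]; apply/andP; split; lra.
Qed.

Lemma open_rat_bigcup (U : set E) : open U ->
  U = \bigcup_(q in [set q : 'rV[rat]_N * 'rV[rat]_N | cbox (rat_rV q.1) (rat_rV q.2) `<=` U])
     box (rat_rV q.1) (rat_rV q.2).
Proof.
move=> oU; apply/seteqP; split => x.
  by move=> Ux; have [q [qx qU]] := open_rat_box oU Ux; exists q.
by move=> [q qU qx]; apply: qU; exact: subset_box_cbox.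
Qed.

Lemma open_measurable_rV (U : set E) : open U -> measurable U.
Proof.
move=> /open_rat_bigcup ->; rewrite bigcup_mkcond.
apply: countable_bigcupT_measurable => // q.
by case: ifP => // _; exact: measurable_box.
Qed.

Lemma closed_measurable_rV (U : set E) : closed U -> measurable U.
Proof.
move=> cU; rewrite -(setCK U); apply: measurableC; apply: open_measurable_rV.
exact: closed_openC.
Qed.

Lemma compact_closed_rV (K : set E) : compact K -> closed K.
Proof. by apply: compact_closed; exact: norm_hausdorff. Qed.

Lemma closed_cbox a b : closed (cbox a b).
Proof. by apply: compact_closed_rV; exact: compact_cbox. Qed.

Lemma continuous_measurable_rV (f : E -> R) : continuous f -> measurable_fun setT f.
Proof.
move=> /continuousP cf; apply: (measurability _ (RGenOpens.measurableE R)).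
move=> _ [_ [a [b ->] <-]]; rewrite setTI; apply: open_measurable_rV.
exact/cf/interval_open.
Qed.

Lemma bounded_sub_cbox (A : set E) : bounded_set A ->
  exists2 M : R, 0 < M & A `<=` cbox (const_mx (- M)) (const_mx M).
Proof.
move=> [M [Mr H]]; exists (`|M| + 1); first by rewrite ltr_wpDl.
move=> x Ax i; rewrite !mxE -ler_norml.
have := H (`|M| + 1); rewrite (le_lt_trans (ler_norm M)) ?ltrDl// => /(_ isT x Ax).
apply: le_trans; rewrite [leRHS]/Num.norm /= mx_normrE.
by apply/bigmax_geP; right => /=; exists (ord0, i).
Qed.

Lemma rV_continuous (T : topologicalType) (h : T -> E) :
  (forall i, continuous (fun t => h t ord0 i)) -> continuous h.
Proof.
move=> ch t; apply/cvgrPdist_lt => e e0.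
have : \forall y \near t, forall i, `|h t ord0 i - h y ord0 i| < e.
  apply: filter_forall => i; have := ch i t; move/cvgrPdist_lt; exact.
apply: filterS => y H.
have : ball (h t) e (h y) by split => // i j; rewrite ord1; exact: H.
by rewrite mx_norm_ball.
Qed.

Lemma partial_eq0_off_closed (K : set E) (f : E -> R) i x : closed K ->
  (forall y, ~ K y -> f y = 0) -> ~ K x -> partial i f x = 0.
Proof.
move=> /closed_openC oK f0 xK; rewrite /partial.
rewrite -[RHS](@derive_cst R E R 0 x (delta_mx ord0 i)); apply: near_eq_derive.
by have := open_nbhs_nbhs (conj oK xK); apply: filterS => y; exact: f0.
Qed.

(** Bounded support is expressed with a cube rather than with a closure because
    cubes are stable under restriction to the slices of [rV_cons]. *)
Definition supported_in_cube (M : R) (f : E -> R) : Prop :=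
  forall x, ~ cbox (const_mx (- M)) (const_mx M) x -> f x = 0.

Lemma supported_in_cube_bounded M f : continuous f -> supported_in_cube M f ->
  exists2 C, 0 <= C & forall x, `|f x| <= C.
Proof.
move=> cf sf.
have : bounded_set (f @` cbox (const_mx (- M)) (const_mx M)).
  apply: compact_bounded; apply: continuous_compact; last exact: compact_cbox.
  exact: continuous_subspaceT.
move=> [C [_ H]]; exists (`|C| + 1); first by rewrite addr_ge0.
move=> x; have [Kx|/sf ->] := pselect (cbox (const_mx (- M)) (const_mx M) x).
  by apply: H; [rewrite (le_lt_trans (ler_norm C)) ?ltrDl|exists x].
by rewrite normr0 addr_ge0.
Qed.

Lemma supported_in_cube_partial M f i :
  supported_in_cube M f -> supported_in_cube M (partial i f).
Proof.
move=> sf x; apply: partial_eq0_off_closed => //.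
exact: closed_cbox.
Qed.
End box.

Lemma bounded_finite_support_integrable d (T : measurableType d) (R : realType)
    (m : {measure set T -> \bar R}) (f : T -> R) (B : set T) (C : R) :
  measurable_fun setT f -> measurable B -> (m B < +oo)%E ->
  (forall x, `|f x| <= C) -> (forall x, ~ B x -> f x = 0) ->
  m.-integrable setT (EFin \o f).
Proof.
move=> mf mB Boo fC fB.
have H : m.-integrable B (EFin \o f).
  apply: (@le_integrable _ _ _ _ _ mB _ (EFin \o cst C)) => //.
  - by apply/measurable_EFinP; exact: measurable_funTS.
  - move=> x _; rewrite /= lee_fin (le_trans (fC x))// ler_norm//.
  - apply/integrableP; split; first exact/measurable_EFinP/measurable_cst.
    by rewrite (integral_cst _ mB `|C|%:E)// lte_mul_pinfty.
rewrite (_ : EFin \o f = (EFin \o f) \_ B); last first.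
  apply/funext => x; rewrite patchE; case: ifPn => // /negP; rewrite inE => /fB /= ->.
  by [].
by rewrite -integrable_mkcond.
Qed.

(** * The integral of a partial derivative *)

Section integral_partial.
Context {R : realType}.

Lemma continuous_support_integrable N M (f : 'rV[R]_N -> R) :
  continuous f -> supported_in_cube M f ->
  (lebesgue_rV R N).-integrable setT (EFin \o f).
Proof.
move=> cf sf; have [C C0 fC] := supported_in_cube_bounded cf sf.
apply: bounded_finite_support_integrable fC sf.
- exact: continuous_measurable_rV.
- exact: measurable_cbox.
- exact: lebesgue_cbox_lty.
Qed.

Lemma rV_cons0 N (x : R * 'rV[R]_N) : rV_cons x ord0 ord0 = x.1.
Proof. by rewrite mxE unlift_none. Qed.

Lemma rV_consS N (x : R * 'rV[R]_N) j : rV_cons x ord0 (lift ord0 j) = x.2 ord0 j.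
Proof. by rewrite mxE liftK. Qed.

Lemma continuous_rV_cons_l N (v : 'rV[R]_N) : continuous (fun a : R => rV_cons (a, v)).
Proof.
apply: rV_continuous => i; case: (unliftP ord0 i) => [j|] ->.
  under eq_fun do rewrite rV_consS; exact: cst_continuous.
by under eq_fun do rewrite rV_cons0; move=> x; exact: cvg_id.
Qed.

Lemma continuous_rV_cons_r N (a : R) : continuous (fun v : 'rV[R]_N => rV_cons (a, v)).
Proof.
apply: rV_continuous => i; case: (unliftP ord0 i) => [j|] ->.
  under eq_fun do rewrite rV_consS; exact: continuous_rV_coord.
by under eq_fun do rewrite rV_cons0; exact: cst_continuous.
Qed.

(** Slicing along [rV_cons] commutes with translation along basis vectors; hence
    partial derivatives of a slice are slices of partial derivatives. *)
Lemma rV_cons_shift0 N (h a : R) (v : 'rV[R]_N) :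
  rV_cons (h + a, v) = h *: delta_mx ord0 ord0 + rV_cons (a, v).
Proof.
apply/rowP => i; rewrite !mxE; case: (unliftP ord0 i) => [j|] ->/=.
  by rewrite mulr0 add0r.
by rewrite mulr1.
Qed.

Lemma rV_cons_shiftS N (h a : R) j (v : 'rV[R]_N) :
  rV_cons (a, h *: delta_mx ord0 j + v) =
  h *: delta_mx ord0 (lift ord0 j) + rV_cons (a, v).
Proof.
apply/rowP => i; rewrite !mxE; case: (unliftP ord0 i) => [k|] ->/=.
  by rewrite !mxE (inj_eq lift_inj).
by rewrite mulr0 add0r.
Qed.

Lemma is_derive_rV_cons0 N (f : 'rV[R]_N.+1 -> R) a v :
  derivable f (rV_cons (a, v)) (delta_mx ord0 ord0) ->
  is_derive a 1 (fun a => f (rV_cons (a, v))) (partial ord0 f (rV_cons (a, v))).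
Proof.
have H : (fun h : R => h^-1 *: (((fun a => f (rV_cons (a, v))) \o shift a)
      (h *: (1 : R)) - f (rV_cons (a, v)))) =
    fun h : R => h^-1 *: ((f \o shift (rV_cons (a, v))) (h *: delta_mx ord0 ord0) -
      f (rV_cons (a, v))).
  by apply/funext => h /=; rewrite -rV_cons_shift0 [h%:A]mulr1.
by move=> df; split; rewrite /partial /derivable /derive H.
Qed.

Lemma is_derive_rV_consS N (f : 'rV[R]_N.+1 -> R) a v j :
  derivable f (rV_cons (a, v)) (delta_mx ord0 (lift ord0 j)) ->
  is_derive v (delta_mx ord0 j) (fun v => f (rV_cons (a, v)))
    (partial (lift ord0 j) f (rV_cons (a, v))).
Proof.
have H : (fun h : R => h^-1 *: (((fun v => f (rV_cons (a, v))) \o shift v)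
      (h *: delta_mx ord0 j) - f (rV_cons (a, v)))) =
    fun h : R => h^-1 *: ((f \o shift (rV_cons (a, v))) (h *: delta_mx ord0 (lift ord0 j)) -
      f (rV_cons (a, v))).
  by apply/funext => h /=; rewrite -rV_cons_shiftS.
by move=> df; split; rewrite /partial /derivable /derive H.
Qed.

Lemma integral_derive_supp (F g : R -> R) (M : R) : continuous g ->
  (forall x : R, is_derive x 1 F (g x)) -> (forall x, M < `|x| -> F x = 0 /\ g x = 0) ->
  (\int[lebesgue_measure]_x (g x)%:E = 0)%E.
Proof.
move=> cg dF H; pose K := `|M| + 1.
have K0 : 0 < K by rewrite ltr_wpDl.
have MK : M < K by rewrite (le_lt_trans (ler_norm M)) ?ltrDl.
have cF : continuous F.
  by move=> x; apply: differentiable_continuous; apply/derivable1_diffP; have [] := dF x.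
transitivity (\int[lebesgue_measure]_(x in `[(- K)%R, K]) (g x)%:E)%E.
  rewrite [RHS]integral_mkcond; apply: eq_integral => x _; rewrite patchE.
  case: ifPn => //; rewrite notin_setE/= in_itv/= -ler_norml => /negP.
  by rewrite -ltNge => xK; have [_ ->] := H x (lt_trans MK xK).
rewrite (@continuous_FTC2 R g F).
- have [|-> _] := H K; first by rewrite gtr0_norm.
  have [|-> _] := H (- K); first by rewrite normrN gtr0_norm.
  by rewrite subee.
- by rewrite gtrN.
- exact: continuous_subspaceT.
- split; first by move=> x _; have [] := dF x.
  + exact/cvg_at_right_filter/cF.
  + exact/cvg_at_left_filter/cF.
- by move=> x _; rewrite derive1E; have [] := dF x.
Qed.

Lemma supported_in_cube_cons N M (f : 'rV[R]_N.+1 -> R) a : supported_in_cube M f ->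
  supported_in_cube M (fun v => f (rV_cons (a, v))).
Proof.
move=> sf v H; apply: sf => H'; apply: H => i.
by have := H' (lift ord0 i); rewrite rV_consS !mxE.
Qed.

(** The case of integration by parts that matters here.  Lebesgue measure on
    R^(N+1) is the image of a product measure, so Fubini allows integrating
    first along the first coordinate, where the fundamental theorem of calculus
    gives 0 (case i = 0), or first along the others, where the induction
    hypothesis applies to the slices (case i > 0). *)
Lemma integral_partial_eq0 N M (f : 'rV[R]_N -> R) i :
  continuous f -> (forall x, derivable f x (delta_mx ord0 i)) ->
  continuous (partial i f) -> supported_in_cube M f ->
  (\int[lebesgue_rV R N]_x (partial i f x)%:E = 0)%E.
Proof.
elim: N => [|N IH] in f i *; first by case: i.
move=> cf df cg sf; have sg := supported_in_cube_partial i sf.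
set g := partial i f in cg sg *.
have mg : measurable_fun setT g := continuous_measurable_rV cg.
have mgc : measurable_fun setT (g \o @rV_cons R N).
  by apply: measurableT_comp => //; exact: measurable_rV_cons.
have [C C0 gC] := supported_in_cube_bounded cg sg.
have ig : (@lebesgue_measure R \x lebesgue_rV R N)%E.-integrable setT
    (EFin \o (g \o @rV_cons R N)).
  apply: (@bounded_finite_support_integrable _ _ _ _ _
    (@rV_cons R N @^-1` cbox (const_mx (- M)) (const_mx M)) C) => //.
  - rewrite -[X in measurable X]setTI; apply: measurable_rV_cons => //.
    exact: measurable_cbox.
  - exact: (lebesgue_cbox_lty (const_mx (- M)) (const_mx M : 'rV[R]_N.+1)).
  - by move=> x /=; exact: gC.
  - by move=> x /=; exact: sg.
rewrite /= /lebesgue_rV_step integral_pushforward//; last first.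
  exact/measurable_EFinP.
rewrite preimage_setT; case: (unliftP ord0 i) => [j|] ij;
  rewrite {}ij in g df cg sg mg mgc gC ig *.
  rewrite -[LHS](integral12_prod_meas1 ig); apply: integral0_eq => a _.
  have D v : is_derive v (delta_mx ord0 j) (fun v => f (rV_cons (a, v))) (g (rV_cons (a, v))).
    by apply: is_derive_rV_consS; exact: df.
  have pE : partial j (fun v => f (rV_cons (a, v))) = fun v => g (rV_cons (a, v)).
    by apply/funext => v; have [] := D v.
  transitivity (\int[lebesgue_rV R N]_v (partial j (fun v => f (rV_cons (a, v))) v)%:E)%E.
    by rewrite pE.
  apply: IH.
  - move=> v; apply: (@continuous_comp _ _ _ (fun v => rV_cons (a, v))).
      exact: continuous_rV_cons_r.
    exact: cf.
  - by move=> v; have [] := D v.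
  - rewrite pE => v; apply: (@continuous_comp _ _ _ (fun v => rV_cons (a, v))).
      exact: continuous_rV_cons_r.
    exact: cg.
  - exact: supported_in_cube_cons.
rewrite -[LHS](integral21_prod_meas1 ig); apply: integral0_eq => v _.
apply: (@integral_derive_supp (fun a => f (rV_cons (a, v))) _ M).
- move=> a; apply: (@continuous_comp _ _ _ (fun a => rV_cons (a, v))).
    exact: continuous_rV_cons_l.
  exact: cg.
- by move=> a; apply: is_derive_rV_cons0; exact: df.
- move=> a Ma; have H : ~ cbox (const_mx (- M)) (const_mx M) (rV_cons (a, v)).
    by move=> /(_ ord0); rewrite rV_cons0 !mxE/= -ler_norml leNgt Ma.
  by split; [exact: sf|exact: sg].
Qed.

End integral_partial.

(** * Smooth bumps on boxes *)

Section flat1.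
Context {R : realType}.
Local Notation f1 := (@flat R 1).

Lemma flat1_ge0 t : 0 <= f1 t.
Proof. by rewrite /flat; case: ifP => // _; rewrite hornerE mul1r expR_ge0. Qed.

Lemma flat1_gt0 t : 0 < t -> 0 < f1 t.
Proof. by move=> t0; rewrite flat_gt0// hornerE mul1r expR_gt0. Qed.

Lemma flat1_le1 t : f1 t <= 1.
Proof.
have [t0|t0] := leP t 0; first by rewrite flat_le0.
by rewrite flat_gt0// hornerE mul1r -expR0 ler_expR oppr_le0 invr_ge0 ltW.
Qed.

Lemma flat1_mono s t : s <= t -> f1 s <= f1 t.
Proof.
have [s0|s0] := leP s 0; first by rewrite (flat_le0 _ s0) flat1_ge0.
move=> st; have t0 := lt_le_trans s0 st.
by rewrite !flat_gt0// !hornerE ?mul1r ler_expR lerN2 lef_pV2.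
Qed.

(** The derivative of exp(-1/t) is s^2 exp(-s) with s = 1/t, at most 2!. *)
Lemma flat1_derive_bound t : `|flat ('X^2 * (1 - 1^`())) t : R| <= 2.
Proof.
have [t0|t0] := leP t 0; first by rewrite flat_le0// normr0.
rewrite flat_gt0// -polyC1 derivC subr0 mulr1 hornerXn ger0_norm; last first.
  by rewrite mulr_ge0 ?expR_ge0// exprn_ge0// invr_ge0 ltW.
by have := @exprn_expRN_le R 2 t^-1; rewrite invr_ge0 ltW// => /(_ isT).
Qed.

Lemma flat1_cvg t : (f1 (n.+1%:R * t) @[n --> \oo] --> ((0 < t)%R%:R : R))%classic.
Proof.
have [t0|t0] := ltP 0 t; last first.
  rewrite (_ : (fun _ => _) = cst 0); first exact: cvg_cst.
  by apply/funext => n; rewrite flat_le0// mulr_ge0_le0.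
rewrite (_ : (fun _ => _) = fun n : nat => expR (- (t^-1 * n.+1%:R^-1))); last first.
  by apply/funext => n; rewrite flat_gt0 ?mulr_gt0// hornerE mul1r invfM mulrC.
rewrite -[X in _ --> X]expR0; apply: continuous_cvg; first exact: continuous_expR.
rewrite -oppr0; apply: cvgN; rewrite -(mulr0 t^-1).
by apply: cvgM; [exact: cvg_cst|exact: cvg_harmonic].
Qed.
End flat1.

Section bump.
Context {R : realType} {N : nat}.
Local Notation E := 'rV[R]_N.
Local Notation mu := (lebesgue_rV R N).
Implicit Types (a b c x : E) (k : R).

(** Positive exactly on the box with corners a and b; the steepness k sharpens it
    towards the indicator of the box as k tends to infinity, and k = 1/e is the
    scale of a cube of half-side e. *)
Definition bump a b k x : R :=
  \prod_(i < N) (flat 1 (k * (x ord0 i - a ord0 i)) * flat 1 (k * (b ord0 i - x ord0 i))).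

Lemma bump_ge0 a b k x : 0 <= bump a b k x.
Proof. by apply: prodr_ge0 => i _; rewrite mulr_ge0 ?flat1_ge0. Qed.

Lemma bump_le1 a b k x : bump a b k x <= 1.
Proof.
apply: prodr_ile1 => i _; rewrite mulr_ge0 ?flat1_ge0//=.
by rewrite mulr_ile1 ?flat1_ge0 ?flat1_le1.
Qed.

Lemma bump_supp a b k x : 0 < k -> ~ box a b x -> bump a b k x = 0.
Proof.
move=> k0 H; apply/eqP; apply/negPn/negP => /prodf_neq0 H'; apply: H => i.
have := H' i isT; rewrite mulf_eq0 negb_or => /andP[h1 h2].
apply/andP; split; rewrite ltNge; apply/negP => h.
  by move: h1; rewrite flat_le0 ?eqxx// pmulr_rle0// subr_le0.
by move: h2; rewrite flat_le0 ?eqxx// pmulr_rle0// subr_le0.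
Qed.

Lemma Ck_prod (I : Type) (s : seq I) (F : I -> E -> R) n :
  (forall i, Ck n (F i)) -> Ck n (fun x => \prod_(i <- s) F i x).
Proof.
move=> CF; elim: s => [|i s IH].
  by under eq_fun do rewrite big_nil; exact: Ck_cst.
by under eq_fun do rewrite big_cons; exact: CkM.
Qed.

Lemma Ck_bump n a b k : Ck n (bump a b k).
Proof.
apply: Ck_prod => i; apply: CkM.
  rewrite (_ : (fun _ => _) = fun x => 1 * flat 1 (k * x ord0 i + - k * a ord0 i)).
    exact: Ck_flat.
  by apply/funext => x; rewrite mul1r; congr flat; ring.
rewrite (_ : (fun _ => _) = fun x => 1 * flat 1 (- k * x ord0 i + k * b ord0 i)).
  exact: Ck_flat.
by apply/funext => x; rewrite mul1r; congr flat; ring.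
Qed.

(** The bound by 1 on the function itself makes the gradient bounds of two
    factors add up in their product. *)
Definition partial_bound L (f : E -> R) :=
  [/\ forall x i, derivable f x (delta_mx ord0 i),
      forall x, `|f x| <= 1 & forall x i, `|partial i f x| <= L].

Lemma partial_boundM L L' f g : partial_bound L f -> partial_bound L' g ->
  partial_bound (L + L') (f \* g).
Proof.
move=> [df f1 fL] [dg g1 gL]; split.
- by move=> x i; apply: derivableM.
- by move=> x; rewrite normrM mulr_ile1.
- move=> x i; rewrite partialM// (le_trans (ler_normD _ _))// !normrM addrC lerD//.
    by rewrite (le_trans _ (fL x i))// ler_piMl.
  by rewrite (le_trans _ (gL x i))// ler_piMl.
Qed.

Lemma partial_bound_flat k d i : partial_bound (`|k| * 2) (fun x => flat 1 (k * x ord0 i + d)).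
Proof.
have D x j := is_derive_flat_affine 1 k d i j x.
split.
- by move=> x j; have [] := D x j.
- by move=> x; rewrite ger0_norm ?flat1_le1// flat1_ge0.
- move=> x j; have [_] := D x j; rewrite /partial => ->.
  case: eqP => _; last by rewrite normr0 mulr_ge0.
  by rewrite normrM ler_wpM2l// flat1_derive_bound.
Qed.

Lemma partial_bound_prod (I : Type) (s : seq I) (F : I -> E -> R) L :
  (forall i, partial_bound L (F i)) ->
  partial_bound (L *+ size s) (fun x => \prod_(i <- s) F i x).
Proof.
move=> CF; elim: s => [|i s IH].
  under eq_fun do rewrite big_nil; split.
  - by move=> x i; exact: derivable_cst.
  - by move=> x; rewrite normr1.
  - by move=> x i; rewrite partial_cst normr0.
by under eq_fun do rewrite big_cons; rewrite mulrS; exact: partial_boundM.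
Qed.

Lemma partial_bump a b k x i : `|partial i (bump a b k) x| <= `|k| * 4 * N%:R.
Proof.
have : partial_bound ((`|k| * 2 + `|k| * 2) *+ size (index_enum 'I_N)) (bump a b k).
  apply: partial_bound_prod => j; apply: partial_boundM.
    rewrite (_ : (fun _ => _) = fun x => flat 1 (k * x ord0 j + - k * a ord0 j)).
      exact: partial_bound_flat.
    by apply/funext => y; congr flat; ring.
  rewrite (_ : (fun _ => _) = fun x => flat 1 (- k * x ord0 j + k * b ord0 j)).
    by rewrite -(normrN k); exact: partial_bound_flat.
  by apply/funext => y; congr flat; ring.
move=> [_ _ /(_ x i)] /le_trans; apply.
rewrite (_ : size _ = N); last by rewrite -[RHS]card_ord cardT enumT.
by rewrite -mulr_natr ler_wpM2r//; lra.
Qed.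

Lemma test_function_bump (Omega : set E) a b k M A B : 0 < k ->
  box a b `<=` cbox A B -> cbox A B `<=` Omega ->
  test_function Omega (fun x => M * bump a b k x).
Proof.
move=> k0 abAB ABO.
have sub : closure [set x | M * bump a b k x != 0] `<=` cbox A B.
  rewrite [X in _ `<=` X](closure_id _).1; last exact: closed_cbox.
  apply: closure_subset => x /= H.
  apply: abAB; apply: contrapT => /(bump_supp k0) b0.
  by move: H; rewrite b0 mulr0 eqxx.
split; last by move=> x /sub; exact: ABO.
- by move=> n; apply: CkM; [exact: Ck_cst|exact: Ck_bump].
- by apply: subclosed_compact sub; [exact: closed_closure|exact: compact_cbox].
Qed.

Lemma bump_cvg a b x :
  (bump a b n.+1%:R x @[n --> \oo] --> (\1_(box a b) x : R))%classic.
Proof.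
have -> : \1_(box a b) x = \prod_(i < N)
  ((0 < x ord0 i - a ord0 i)%R%:R * (0 < b ord0 i - x ord0 i)%R%:R) :> R.
  rewrite indicE; have [H|H] := pselect (box a b x).
    rewrite mem_set// big1// => i _; have /andP[h1 h2] := H i.
    by rewrite !subr_gt0 h1 h2 mulr1.
  rewrite memNset//; apply/esym/eqP; apply/negPn/negP => /prodf_neq0 H'; apply: H => i.
  have := H' i isT; rewrite !subr_gt0.
  by do 2 (case: (_ < _); rewrite ?mulr0 ?mul0r ?eqxx//).
rewrite /bump; elim: (index_enum _) => [|i s IH].
  rewrite big_nil; under eq_fun do rewrite big_nil; exact: cvg_cst.
rewrite big_cons; under eq_fun do rewrite big_cons.
apply: cvgM => //; apply: cvgM; exact: flat1_cvg.
Qed.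

End bump.

(** * Weak gradients: existence for test functions and uniqueness *)

Section weak.
Context {R : realType} {N : nat}.
Local Notation E := 'rV[R]_N.
Local Notation mu := (lebesgue_rV R N).
Implicit Types (Omega : set E) (phi u f g : E -> R).

Lemma test_function_supp Omega phi : test_function Omega phi ->
  exists M, supported_in_cube M phi.
Proof.
move=> [_ cphi _]; have [M M0 sub] := bounded_sub_cbox (compact_bounded cphi).
exists M => x xM; apply: contrapT => /eqP px; apply: xM; apply: sub.
by apply: subset_closure.
Qed.

Lemma test_function_out Omega phi x : test_function Omega phi -> ~ Omega x -> phi x = 0.
Proof.
move=> [_ _ sub] Ox; apply: contrapT => /eqP px; apply: Ox; apply: sub.
by apply: subset_closure.
Qed.

Lemma test_function_C1 Omega phi : test_function Omega phi ->
  [/\ continuous phi, forall x i, derivable phi x (delta_mx ord0 i) &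
      forall i, continuous (partial i phi)].
Proof.
move=> [/(_ 1%N) /= [cphi H] _ _]; split => //.
  by move=> x i; have [] := H i.
by move=> i; have [] := H i.
Qed.

Lemma supported_in_cubeM M f g : supported_in_cube M f -> supported_in_cube M (f \* g).
Proof. by move=> sf x xM; rewrite /= sf// mul0r. Qed.

Lemma test_function_loc_integrable Omega f M : measurable Omega ->
  continuous f -> supported_in_cube M f -> loc_integrable Omega f.
Proof.
move=> mO cf sf; split.
  by apply: measurable_funTS; exact: continuous_measurable_rV.
move=> K cK KO; apply: (@integrableS _ _ _ _ setT) => //.
- by apply: closed_measurable_rV; exact: compact_closed_rV.
- exact: continuous_support_integrable sf.
Qed.

Lemma Rintegral_out Omega f : (forall x, ~ Omega x -> f x = 0) ->
  \int[mu]_(x in Omega) f x = \int[mu]_x f x.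
Proof.
move=> H; rewrite Rintegral_mkcond; apply: eq_Rintegral => x _.
by rewrite patchE; case: ifPn => // /negP; rewrite inE => /H ->.
Qed.

(** Apply [integral_partial_eq0] to the product u * phi, which is supported in
    Omega; integrals over Omega may then be taken over the whole space. *)
Lemma weak_gradient_test Omega u : measurable Omega -> test_function Omega u ->
  is_weak_gradient Omega u (gradient u).
Proof.
move=> mO tu; have [M sM] := test_function_supp tu.
have [cu du cdu] := test_function_C1 tu.
split.
- exact: test_function_loc_integrable sM.
- move=> i; rewrite (_ : (fun _ => _) = partial i u).
    exact: (test_function_loc_integrable mO (cdu i) (supported_in_cube_partial i sM)).
  by apply/funext => x; rewrite mxE.
- move=> phi i tphi; have [cp dp cdp] := test_function_C1 tphi.
  rewrite Rintegral_out; last by move=> x Ox; rewrite (test_function_out tu Ox) mul0r.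
  rewrite [X in _ = - X]Rintegral_out; last first.
    by move=> x Ox; rewrite (test_function_out tphi Ox) mulr0.
  have pE x : partial i (u \* phi) x = u x * partial i phi x + (gradient u x) ord0 i * phi x.
    by rewrite partialM// mxE [X in _ + X]mulrC.
  have c1 : continuous (u \* partial i phi).
    by move=> x; exact: (continuousM (cu x) (cdp i x)).
  have c2 : continuous (partial i u \* phi).
    by move=> x; exact: (continuousM (cdu i x) (cp x)).
  have i1 : mu.-integrable setT (EFin \o (fun x => u x * partial i phi x)).
    exact: (continuous_support_integrable c1 (supported_in_cubeM _ sM)).
  have i2 : mu.-integrable setT (EFin \o (fun x => (gradient u x) ord0 i * phi x)).
    rewrite (_ : (fun _ => _) = partial i u \* phi).
      exact: (continuous_support_integrable c2
        (supported_in_cubeM _ (supported_in_cube_partial i sM))).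
    by apply/funext => x; rewrite mxE.
  apply/eqP; rewrite -addr_eq0 -RintegralD// /Rintegral.
  under eq_integral do rewrite -pE.
  rewrite (@integral_partial_eq0 _ _ M)//.
  - by move=> x; exact: (continuousM (cu x) (cp x)).
  - by move=> x; apply: derivableM.
  - have -> : partial i (u \* phi) = (u \* partial i phi) \+ (partial i u \* phi).
      by apply/funext => x; rewrite pE mxE.
    by move=> x; exact: (continuousD (c1 x) (c2 x)).
  - exact: supported_in_cubeM.
Qed.

(** Open sets are countable unions of rational boxes, and preimages of open
    intervals by the coordinates are open. *)
Lemma box_sigma : (@measurable _ E) = <<s [set S | exists a b : E, S = box a b] >>.
Proof.
set G := [set S | _].
have GU (U : set E) : open U -> <<s G >> U.
  move=> /open_rat_bigcup ->; rewrite bigcup_mkcond.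
  apply: (@countable_bigcupT_measurable _ (g_sigma_algebraType G)) => // q.
  by case: ifP => _; [apply: sub_sigma_algebra; eexists; eexists|exact: sigma_algebra0].
apply/seteqP; split; last first.
  apply: smallest_sub; first exact: sigma_algebra_measurable.
  by move=> _ [a [b ->]]; exact: measurable_box.
apply: smallest_sub; first exact: smallest_sigma_algebra.
rewrite -bigcup_seq => A [/= i _ [B mB <-]].
suff : measurable_fun (setT : set (g_sigma_algebraType G))
    (@rV_coord R N i : g_sigma_algebraType G -> R).
  exact.
apply: (measurability _ (RGenOpens.measurableE R)).
move=> _ [_ [a [b ->] <-]]; rewrite setTI; apply: GU.
have /continuousP cc := @continuous_rV_coord R N i.
exact/cc/interval_open.
Qed.

Lemma box_setI a b c d : box a b `&` box c d =
  box (\row_i Num.max (a ord0 i) (c ord0 i)) (\row_i Num.min (b ord0 i) (d ord0 i)) :> set E.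
Proof.
apply/seteqP; split => x.
  move=> [H1 H2] i; rewrite !mxE gt_max lt_min.
  by have /andP[-> ->] := H1 i; have /andP[-> ->] := H2 i.
move=> H; split => i; have := H i; rewrite !mxE gt_max lt_min;
by move=> /andP[/andP[h1 h2] /andP[h3 h4]]; apply/andP; split.
Qed.

(** Boxes form a pi-system generating the Borel sets, so by Dynkin's theorem an
    integrable function with zero integral over each box has zero integral over
    each Borel set. *)
Lemma ae_eq0_of_boxes (g : E -> R) A B : mu.-integrable (box A B) (EFin \o g) ->
  (forall a b, box a b `<=` box A B -> \int[mu]_(x in box a b) (g x)%:E = 0)%E ->
  ae_eq mu (box A B) (EFin \o g) (cst 0%E).
Proof.
move=> ig H; have mD := measurable_box A B.
have igS S : measurable S -> mu.-integrable (box A B `&` S) (EFin \o g).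
  by move=> mS; apply: (integrableS mD) => //; exact: measurableI.
suff key S : measurable S -> (\int[mu]_(x in box A B `&` S) (g x)%:E = 0)%E.
  apply: integral_ae_eq => // S SD mS.
  by rewrite integral0 -[RHS](key S mS) (setIidr SD).
rewrite box_sigma; move: S; apply: dynkin_induction.
- exact: box_sigma.
- by move=> _ _ [a [b ->]] [c [d ->]]; rewrite box_setI; eexists; eexists.
- by rewrite setIT; exact: H.
- by move=> _ [a [b ->]]; rewrite box_setI; apply: H; rewrite -box_setI; exact: subIsetl.
- move=> S mS HS; have := H A B (@subset_refl _ _).
  rewrite -[X in (\int[mu]_(x in X) _)%E = _](setIT (box A B)) -(setUv S) setIUr.
  rewrite integral_setU; first by rewrite [X in (X + _)%E]HS add0e.
  + exact: measurableI.
  + by apply: measurableI => //; exact: measurableC.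
  + by rewrite -setIUr setUv setIT; exact: (measurable_int _ ig).
  + by apply/disj_set2P; rewrite setIACA setICr setI0.
- move=> F mF tF HF; rewrite setI_bigcupr integral_bigcup.
  + by rewrite eseries0.
  + by apply/trivIsetP => i j _ _ ij; rewrite setIACA (trivIsetP.1 tF)// setI0.
  + by move=> k; exact: measurableI.
  + by rewrite -setI_bigcupr; apply: igS; exact: bigcup_measurable.
Qed.

(** The bumps of increasing steepness on a box converge boundedly to its
    indicator, and each of them is a test function; conclude by dominated
    convergence. *)
Lemma integral_box_eq0 Omega (g : E -> R) A B a b : loc_integrable Omega g ->
  (forall phi, test_function Omega phi -> \int[mu]_(x in Omega) (g x * phi x) = 0) ->
  cbox A B `<=` Omega -> box a b `<=` box A B ->
  (\int[mu]_(x in box a b) (g x)%:E = 0)%E.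
Proof.
move=> [mg lg] H KO abAB; set K := cbox A B in KO *.
have abK : box a b `<=` K by apply: subset_trans abAB _; exact: subset_box_cbox.
have mK : measurable K := measurable_cbox A B.
have ig : mu.-integrable K (EFin \o g) by apply: lg => //; exact: compact_cbox.
have mgK : measurable_fun K g := (measurable_EFinP _ _).1 (measurable_int _ ig).
have b0 n x : ~ box a b x -> bump a b n.+1%:R x = 0 by apply: bump_supp.
pose f_ n x := (g x * bump a b n.+1%:R x)%:E.
pose f x := (g x * \1_(box a b) x)%:E.
have mf_ n : measurable_fun K (f_ n).
  apply/measurable_EFinP; apply: measurable_funM => //.
  by apply: measurable_funTS; apply: continuous_measurable_rV; exact: (Ck_bump 0).
have domf n x : K x -> (`|f_ n x| <= (EFin \o (Num.norm \o g)) x)%E.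
  by move=> _; rewrite lee_fin normrM ler_piMr// ger0_norm ?bump_ge0 ?bump_le1.
have cf x : K x -> (f_ ^~ x @ \oo --> f x)%classic.
  move=> _; apply: cvg_EFin; first exact: nearW.
  by apply: cvgM; [exact: cvg_cst|exact: bump_cvg].
have ign : mu.-integrable K (EFin \o (Num.norm \o g)) by exact: integrable_norm.
have := dominated_cvg mK mf_ cf _ ign domf.
have f_0 n : (\int[mu]_(x in K) f_ n x = 0)%E.
  have tb : test_function Omega (fun x => 1 * bump a b n.+1%:R x).
    by apply: (@test_function_bump _ _ _ _ _ _ _ A B).
  have := H _ tb; rewrite /Rintegral.
  under eq_integral do rewrite mul1r.
  have -> : (\int[mu]_(x in Omega) f_ n x = \int[mu]_(x in K) f_ n x)%E.
    rewrite integral_mkcond [RHS]integral_mkcond; apply: eq_integral => x _.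
    rewrite !patchE; case: ifPn => [|/negP]; rewrite inE => Ox;
      case: ifPn => [|/negP]; rewrite inE => Kx //.
      by rewrite /f_ b0 ?mulr0// => /abK.
    by case: Ox; exact: KO.
  have : mu.-integrable K (f_ n).
    apply: le_integrable ign => // x Kx.
    by rewrite (le_trans (domf n x Kx))//= normr_id.
  by move=> /(integrable_fin_num mK); case: (integral _ _ _) => //= r _ ->.
under eq_cvg do rewrite f_0.
move=> /(_ (fun _ _ => erefl)) cv.
have : (\int[mu]_(x in K) f x = 0)%E.
  by rewrite -(cvg_lim _ cv)//; exact: lim_cst.
rewrite integral_mkcond => <-; rewrite [LHS]integral_mkcond; apply: eq_integral => x _.
rewrite !patchE /f indicE; case: ifPn => [xab|_].
  by rewrite mem_set ?mulr1//; apply: abK; rewrite inE in xab.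
by rewrite mulr0; case: ifP.
Qed.

(** The fundamental lemma of the calculus of variations: g vanishes almost
    everywhere on each of the countably many rational boxes filling Omega. *)
Lemma ae_eq0_of_test_function Omega (g : E -> R) : open Omega -> loc_integrable Omega g ->
  (forall phi, test_function Omega phi -> \int[mu]_(x in Omega) (g x * phi x) = 0) ->
  {ae mu, forall x, Omega x -> g x = 0}.
Proof.
move=> oO lg H.
pose I := ('rV[rat]_N * 'rV[rat]_N)%type.
pose F (q : I) := [set x | cbox (rat_rV q.1) (rat_rV q.2) `<=` Omega /\
   box (rat_rV q.1) (rat_rV q.2) x /\ g x <> 0] : set E.
have nF q : mu.-negligible (F q).
  have [KO|nKO] := pselect (cbox (rat_rV q.1 : E) (rat_rV q.2) `<=` Omega); last first.
    by rewrite (_ : F q = set0); [exact: negligible_set0|apply/seteqP; split => // x [/nKO]].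
  have [_ lg2] := lg.
  have ig : mu.-integrable (box (rat_rV q.1) (rat_rV q.2)) (EFin \o g).
    apply: (integrableS (measurable_cbox _ _) (measurable_box _ _) (@subset_box_cbox _ _ _ _)).
    by apply: lg2 => //; exact: compact_cbox.
  have := ae_eq0_of_boxes ig (fun a b => integral_box_eq0 lg H KO).
  by apply: negligibleS => x [_ [bx gx]] /= /(_ bx) [].
pose G n := if unpickle n is Some q then F q else set0.
have : mu.-negligible (\bigcup_n G n).
  by apply: negligible_bigcup => n; rewrite /G; case: unpickle => //; exact: negligible_set0.
apply: negligibleS => x /= /not_implyP[Ox gx].
have [q [bq KO]] := open_rat_box oO Ox.
by exists (pickle q) => //; rewrite /G pickleK.
Qed.

(** [weak_gradient] is an arbitrary choice of a weak gradient; this lemma is what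
    makes the Sobolev norm of an explicit function computable. *)
Lemma weak_gradient_unique Omega u (g h : E -> E) : open Omega ->
  is_weak_gradient Omega u g -> is_weak_gradient Omega u h ->
  forall i, {ae mu, forall x, Omega x -> g x ord0 i = h x ord0 i}.
Proof.
move=> oO [_ lg Hg] [_ lh Hh] i.
have mO := open_measurable_rV oO.
have [mgi lgi] := lg i; have [mhi lhi] := lh i.
have lgh : loc_integrable Omega (fun x => g x ord0 i - h x ord0 i).
  split; first exact: measurable_funB.
  move=> K cK KO; have mK : measurable K by apply: closed_measurable_rV; exact: compact_closed_rV.
  rewrite (_ : _ \o _ = (EFin \o (fun x => g x ord0 i)) \- (EFin \o (fun x => h x ord0 i)))%E.
    by apply: integrableB; [|exact: lgi|exact: lhi].
  by [].
have : {ae mu, forall x, Omega x -> g x ord0 i - h x ord0 i = 0}.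
  apply: ae_eq0_of_test_function lgh _ => // phi tphi.
  (* A locally integrable function times a test function is integrable over
     Omega: the support of the latter is a compact subset of Omega. *)
  have ip f : loc_integrable Omega f -> mu.-integrable Omega (EFin \o (fun x => f x * phi x)).
    move=> [mf lf]; have [_ cS SO] := tphi; set S := closure _ in cS SO.
    have [M sM] := test_function_supp tphi.
    have [cp _ _] := test_function_C1 tphi.
    have [C C0 pC] := supported_in_cube_bounded cp sM.
    have mS : measurable S by apply: closed_measurable_rV; exact: closed_closure.
    have iS : mu.-integrable S (EFin \o (fun x => f x * phi x)).
      have iC : mu.-integrable S (EFin \o (fun x => C * f x)).
        rewrite (_ : _ \o _ = (fun x => C%:E * (f x)%:E)%E); last first.
          by apply/funext => x; rewrite /= EFinM.
        by apply: integrableZl => //; exact: lf.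
      apply: le_integrable iC => //.
        apply/measurable_EFinP; apply: measurable_funM.
          exact: measurable_funS mf.
        by apply: measurable_funTS; exact: continuous_measurable_rV.
      by move=> x _; rewrite /= lee_fin !normrM mulrC (ger0_norm C0) ler_wpM2r.
    rewrite integrable_mkcond// (_ : _ \_ _ = (EFin \o (fun x => f x * phi x)) \_ S).
      by rewrite -integrable_mkcond.
    apply/funext => x; rewrite !patchE; case: ifPn => [|/negP]; rewrite inE => Ox;
      case: ifPn => [|/negP]; rewrite inE => Sx //.
      rewrite /= (_ : phi x = 0) ?mulr0//; apply: contrapT => /eqP px; apply: Sx.
      exact: subset_closure.
    by case: Ox; exact: SO.
  under eq_Rintegral do rewrite mulrBl.
  rewrite RintegralB//; [|exact: ip|exact: ip].
  have := Hg phi i tphi; rewrite (Hh phi i tphi) => /oppr_inj ->.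
  by rewrite subrr.
by apply: filterS => x H Ox; apply/eqP; rewrite -subr_eq0; apply/eqP; exact: H.
Qed.

End weak.

(** * Lebesgue norms and the Sobolev norm of a test function *)

Section Ls.
Context {R : realType} {N : nat}.
Local Notation E := 'rV[R]_N.
Local Notation mu := (lebesgue_rV R N).
Implicit Types (Omega : set E) (u f g : E -> R) (p : R).

(** Since 0 `^ p = 0 for nonzero p, extending f by zero off Omega does not affect
    the integral. *)
Lemma Ls_norm_pow Omega p f : p != 0 ->
  (Ls_norm Omega p%:E f `^ p = \int[mu]_(x in Omega) (`|f x| `^ p)%:E)%E.
Proof.
move=> p0; rewrite /Ls_norm poweR_Lnorm// [RHS]integral_mkcond.
apply: eq_integral => x _; rewrite /= !patchE; case: ifP => // _.
by rewrite normr0 powR0.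
Qed.

Lemma measurable_normr_powR Omega p f : measurable_fun Omega f ->
  measurable_fun Omega (fun x => (`|f x| `^ p)%:E).
Proof.
move=> mf; apply/measurable_EFinP.
apply: (measurableT_comp (measurable_powR p)).
exact: (measurableT_comp (@normr_measurable R setT)).
Qed.

Lemma Ls_normE Omega p f : p != 0 ->
  (Ls_norm Omega p%:E f = (\int[mu]_(x in Omega) (`|f x| `^ p)%:E) `^ p^-1)%E.
Proof.
by move=> p0; rewrite -Ls_norm_pow// -poweRrM mulfV// poweRe1// Lnorm_ge0.
Qed.

Lemma Ls_norm_ae_eq Omega p f g : p != 0 -> measurable Omega ->
  measurable_fun Omega f -> measurable_fun Omega g ->
  {ae mu, forall x, Omega x -> f x = g x} ->
  Ls_norm Omega p%:E f = Ls_norm Omega p%:E g.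
Proof.
move=> p0 mO mf mg fg; rewrite !Ls_normE//; congr poweR.
apply: ae_eq_integral => //; [exact: measurable_normr_powR|exact: measurable_normr_powR|].
by apply: filterS fg => x H /H ->.
Qed.

Lemma Ls_norm_cst0 Omega p : p != 0 -> Ls_norm Omega p%:E (cst 0) = 0%E.
Proof.
move=> p0; rewrite Ls_normE// integral0_eq ?poweR0r ?invr_neq0//.
by move=> x _; rewrite /= normr0 powR0.
Qed.

Lemma integral_powR_le Omega p f C B : 0 < p -> measurable Omega ->
  measurable_fun Omega f -> measurable B -> 0 <= C ->
  (forall x, Omega x -> `|f x| <= C) -> (forall x, Omega x -> ~ B x -> f x = 0) ->
  (\int[mu]_(x in Omega) (`|f x| `^ p)%:E <= (C `^ p)%:E * mu B)%E.
Proof.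
move=> p0 mO mf mB C0 fC fB.
rewrite -integral_cst// [leRHS]integral_mkcond [leLHS]integral_mkcond.
apply: ge0_le_integral => //.
- by move=> x _; apply: erestrict_ge0 => // y _; rewrite lee_fin powR_ge0.
- exact: (measurable_restrictT _ mO).1 (measurable_normr_powR p mf).
- exact: (measurable_restrictT _ mB).1 (measurable_cst _).
- move=> x _; rewrite !patchE; case: ifPn => Ox.
    rewrite inE in Ox; case: ifPn => [_|/negP].
      by rewrite lee_fin ge0_ler_powR ?nnegrE ?fC// ltW.
    by rewrite inE => /fB -> //; rewrite normr0 powR0// gt_eqF.
  by case: ifP => // _; rewrite lee_fin powR_ge0.
Qed.

Lemma in_Ls_bounded Omega p f C : 0 < p -> measurable Omega -> (mu Omega < +oo)%E ->
  measurable_fun Omega f -> 0 <= C -> (forall x, Omega x -> `|f x| <= C) ->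
  in_Ls Omega p%:E f.
Proof.
move=> p0 mO Ooo mf C0 fC; rewrite /in_Ls /Lfun; apply/andP; rewrite !inE; split.
  exact: (measurable_restrictT _ mO).1.
rewrite /= /finite_norm -[X in (X < _)%E]/(Ls_norm Omega p%:E f).
rewrite Ls_normE ?gt_eqF// poweR_lty//.
apply: le_lt_trans (integral_powR_le p0 mO mf mO C0 fC _) _ => //.
by rewrite lte_mul_pinfty// lee_fin powR_ge0.
Qed.

Lemma in_Ls_ae_eq Omega p f g : p != 0 -> measurable Omega -> measurable_fun Omega g ->
  {ae mu, forall x, Omega x -> f x = g x} -> in_Ls Omega p%:E f -> in_Ls Omega p%:E g.
Proof.
move=> p0 mO mg fg /andP[]; rewrite !inE => mf ff; apply/andP; rewrite !inE; split.
  exact: (measurable_restrictT _ mO).1.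
rewrite /= /finite_norm -[X in (X < _)%E]/(Ls_norm Omega p%:E g) -(@Ls_norm_ae_eq _ _ f)//.
exact: (measurable_restrictT _ mO).2 mf.
Qed.

Lemma measurable_euclidean_norm Omega (g : E -> E) :
  (forall i, measurable_fun Omega (fun x => g x ord0 i)) ->
  measurable_fun Omega (fun x => euclidean_norm (g x)).
Proof.
move=> mg; apply: (@measurableT_comp _ _ _ _ _ _ (@Num.sqrt R)).
  by apply: continuous_measurable_fun; exact: sqrt_continuous.
by apply: measurable_sum => i; apply: measurable_funX.
Qed.

Lemma euclidean_norm_le (v : E) L : 0 <= L -> (forall i, `|v ord0 i| <= L) ->
  euclidean_norm v <= N%:R * L.
Proof.
move=> L0 H; rewrite /euclidean_norm -[leRHS]ger0_norm ?mulr_ge0// -sqrtr_sqr.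
rewrite ler_wsqrtr// (@le_trans _ _ (\sum_(i < N) L ^+ 2))//.
  by apply: ler_sum => i _; rewrite -real_normK ?num_real// lerXn2r ?nnegrE.
rewrite sumr_const card_ord -[leLHS]mulr_natl exprMn ler_wpM2r ?sqr_ge0//.
by rewrite -natrX ler_nat; case: (N) => // n; rewrite -{1}(expn1 n.+1) leq_pexp2l.
Qed.

Lemma weak_gradient_testP Omega u : open Omega -> test_function Omega u ->
  is_weak_gradient Omega u (weak_gradient Omega u) /\
  forall i, {ae mu, forall x, Omega x -> weak_gradient Omega u x ord0 i = partial i u x}.
Proof.
move=> oO tu; have mO := open_measurable_rV oO.
have wu := weak_gradient_test mO tu.
have ww : is_weak_gradient Omega u (weak_gradient Omega u).
  by apply: (@xgetPex _ (fun=> 0) [set g | is_weak_gradient Omega u g]); exists (gradient u).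
split => // i; have := weak_gradient_unique oO ww wu i.
by apply: filterS => x H /H ->; rewrite mxE.
Qed.

Lemma W_norm_test Omega p u : p != 0 -> open Omega -> test_function Omega u ->
  W_norm Omega p u = Ls_norm Omega p%:E (fun x => euclidean_norm (gradient u x)).
Proof.
move=> p0 oO tu; have [[_ mw _] ae] := weak_gradient_testP oO tu.
have mO := open_measurable_rV oO.
have [_ mg _] := weak_gradient_test mO tu.
apply: Ls_norm_ae_eq => //.
- by apply: measurable_euclidean_norm => i; have [] := mw i.
- by apply: measurable_euclidean_norm => i; have [] := mg i.
- have : \forall x \ae mu, forall i, Omega x -> weak_gradient Omega u x ord0 i = partial i u x.
    by apply: filter_forall => i; exact: ae.
  apply: filterS => x H Ox; congr euclidean_norm; apply/rowP => i.
  by rewrite H// mxE.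
Qed.

(** The constant sequence u approximates u: the classical gradient agrees almost
    everywhere with the chosen weak one. *)
Lemma test_function_W1p0 Omega p u : 0 < p -> open Omega -> (mu Omega < +oo)%E ->
  test_function Omega u -> W1p0 Omega p u.
Proof.
move=> p0 oO Ooo tu; have [ww ae] := weak_gradient_testP oO tu.
have mO := open_measurable_rV oO; have pn0 : p != 0 by rewrite gt_eqF.
have [cu du cdu] := test_function_C1 tu.
have [M sM] := test_function_supp tu.
have [_ mw _] := ww.
have mp i : measurable_fun Omega (partial i u).
  by apply: measurable_funTS; exact: continuous_measurable_rV.
split; first split => //.
- have [C C0 uC] := supported_in_cube_bounded cu sM.
  apply: (@in_Ls_bounded _ _ _ C) => //.
  by apply: measurable_funTS; exact: continuous_measurable_rV.
- move=> i; have [C C0 uC] := supported_in_cube_bounded (cdu i) (supported_in_cube_partial i sM).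
  apply: (@in_Ls_ae_eq _ _ (partial i u)) => //.
  + by have [] := mw i.
  + by apply: filterS (ae i) => x H /H ->.
  + exact: (@in_Ls_bounded _ _ _ C).
exists (fun=> u); split => //.
  rewrite (_ : (fun _ => _) = cst 0%E); first exact: cvg_cst.
  apply/funext => n; rewrite (_ : u \- u = cst 0) ?Ls_norm_cst0//.
  by apply/funext => x; rewrite /= subrr.
move=> i; rewrite (_ : (fun _ => _) = cst 0%E); first exact: cvg_cst.
apply/funext => n; rewrite -(@Ls_norm_cst0 Omega p)//.
apply: Ls_norm_ae_eq => //.
  by apply: measurable_funB => //; have [] := mw i.
by apply: filterS (ae i) => x H /H ->; rewrite subrr.
Qed.

Lemma test_function0 Omega : test_function Omega (cst 0).
Proof.
have s0 : [set x : E | (cst 0 : E -> R) x != 0] = set0.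
  by apply/seteqP; split => x //=; rewrite eqxx.
split; rewrite ?s0 ?closure0//; [by move=> k; exact: Ck_cst|exact: compact0].
Qed.

Lemma W_norm0 Omega p : p != 0 -> open Omega -> W_norm Omega p (cst 0) = 0%E.
Proof.
move=> p0 oO; rewrite W_norm_test//; last exact: test_function0.
rewrite (_ : (fun _ => _) = cst 0) ?Ls_norm_cst0//; apply/funext => x.
rewrite /euclidean_norm big1 ?sqrtr0// => i _.
by rewrite mxE partial_cst expr0n.
Qed.
End Ls.

(** * The lower-order terms near the origin, and the concentrating bumps *)

Section powR.
Context {R : realType}.

Lemma powR_solve (s c : R) : 0 < s -> 0 < c -> exists2 x, 0 < x & x `^ s = c.
Proof.
move=> s0 c0; exists (c `^ s^-1); first exact: powR_gt0.
by rewrite -powRrM mulVf ?gt_eqF// powRr1// ltW.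
Qed.

Lemma powR_small (s c : R) : 0 < s -> 0 < c ->
  exists2 d, 0 < d & forall e, 0 < e -> e < d -> e `^ s < c.
Proof.
move=> s0 c0; have [d d0 <-] := powR_solve s0 c0; exists d => // e e0 ed.
by rewrite gt0_ltr_powR// nnegrE ltW.
Qed.
End powR.

Section main.
Context {R : realType} {N : nat}.
Local Notation E := 'rV[R]_N.
Local Notation mu := (lebesgue_rV R N).
Implicit Types (Omega : set E) (u v : E -> R) (p q varpi r lambda rho M e : R).

Lemma Linfty_norm_ae Omega u rho : (Ls_norm Omega +oo u < rho%:E)%E ->
  {ae mu, forall x, Omega x -> `|u x| <= rho}.
Proof.
rewrite /Ls_norm unlock; case: ifPn => [_ /ltW /ess_supP|].
  by apply: filterS => x H Ox; move: H; rewrite /= patchE mem_set// lee_fin.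
rewrite -leNgt => mu0 _; exists setT; split => //.
by apply/eqP; rewrite eq_le mu0 measure_ge0.
Qed.

Lemma C1_norm_bound Omega u rho : (C1_norm Omega u < rho%:E)%E ->
  forall x, Omega x -> `|u x| <= rho.
Proof.
move=> H x Ox; rewrite -lee_fin (le_trans _ (ltW H))//.
apply: (@le_trans _ _ (ereal_sup [set (`|u x|)%:E | x in Omega])).
  by apply: ereal_sup_ubound; exists x.
rewrite leeDl//; apply: (@le_trans _ _ (euclidean_norm (gradient u x))%:E).
  by rewrite lee_fin sqrtr_ge0.
by apply: ereal_sup_ubound; exists x.
Qed.

(** Where |v| <= rho one has lambda / varpi * |v|^varpi <= |v|^q / q, because the
    value of rho makes this an equality at |v| = rho and varpi > q.  So the
    difference of the two lower-order terms is nonnegative.  The upper bound on v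
    and the finite volume also make the subtracted term finite, which excludes
    the indeterminate difference of infinities. *)
Lemma lower_order_dominates Omega v q varpi lambda rho (a : \bar R) :
  measurable Omega -> (mu Omega < +oo)%E -> 0 < q -> q < varpi -> 0 < lambda ->
  0 < rho -> rho `^ (varpi - q) = varpi / (lambda * q) ->
  measurable_fun Omega v -> {ae mu, forall x, Omega x -> `|v x| <= rho} -> (0 <= a)%E ->
  (0 <= a + (q^-1)%:E * Ls_norm Omega q%:E v `^ q
       - (lambda / varpi)%:E * Ls_norm Omega varpi%:E v `^ varpi)%E.
Proof.
move=> mO Ooo q0 qvp l0 rho0 rhoE mv vrho a0.
have vp0 : 0 < varpi := lt_trans q0 qvp.
have lv0 : 0 <= lambda / varpi by rewrite divr_ge0 ?ltW.
have pos s (c : R) x : 0 <= c -> (0 <= c%:E * (`|v x| `^ s)%:E)%E.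
  by move=> c0; rewrite mule_ge0 ?lee_fin ?powR_ge0.
have mpow s (c : R) : measurable_fun Omega (fun x => c%:E * (`|v x| `^ s)%:E)%E.
  by apply: measurable_funeM; exact: measurable_normr_powR.
have scale s (c : R) : s != 0 -> 0 <= c -> (c%:E * Ls_norm Omega s%:E v `^ s =
    \int[mu]_(x in Omega) (c%:E * (`|v x| `^ s)%:E))%E.
  move=> s0 c0; rewrite Ls_norm_pow// ge0_integralZl//.
  exact: measurable_normr_powR.
rewrite !scale ?gt_eqF ?invr_ge0 ?(ltW q0)//.
set B := (\int[mu]_(x in Omega) (_%:E * (_ `^ q)%:E))%E.
set C := (\int[mu]_(x in Omega) (_%:E * (_ `^ varpi)%:E))%E.
have C0 : (0 <= C)%E by apply: integral_ge0 => x _; exact: pos.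
have CB : (C <= B)%E.
  apply: ae_ge0_le_integral => //.
  - by move=> x _; exact: pos.
  - by move=> x _; apply: pos; rewrite invr_ge0 ltW.
  - apply: filterS vrho => x H /H vx; rewrite -!EFinM lee_fin.
    have [->|v0] := eqVneq (`|v x|) 0.
      by rewrite !powR0 ?gt_eqF// !mulr0.
    have -> : `|v x| `^ varpi = `|v x| `^ (varpi - q) * `|v x| `^ q.
      by rewrite -powRD ?v0 ?implybT// subrK.
    rewrite mulrA ler_wpM2r ?powR_ge0//.
    have -> : q^-1 = lambda / varpi * rho `^ (varpi - q).
      by rewrite rhoE; field; rewrite !gt_eqF.
    by rewrite ler_wpM2l// ge0_ler_powR ?nnegrE ?subr_ge0 ?(ltW rho0) ?(ltW qvp).
have Cfin : C \is a fin_num.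
  rewrite ge0_fin_numE//.
  apply: (@le_lt_trans _ _ (\int[mu]_(x in Omega) (lambda / varpi * rho `^ varpi)%:E)%E).
    apply: ae_ge0_le_integral => //.
    - by move=> x _; exact: pos.
    - by move=> x _; rewrite lee_fin mulr_ge0 ?powR_ge0.
    apply: filterS vrho => x H /H vx; rewrite -!EFinM lee_fin ler_wpM2l//.
    by rewrite ge0_ler_powR ?nnegrE ?(ltW rho0) ?(ltW vp0).
  by rewrite integral_cst// lte_mul_pinfty// lee_fin mulr_ge0 ?powR_ge0.
by rewrite sube_ge0 ?Cfin// (le_trans CB)// leeDr.
Qed.

Lemma functional_cst0 Omega p q varpi r lambda : open Omega -> p != 0 -> q != 0 ->
  varpi != 0 -> r != 0 -> functional Omega p q varpi r lambda (cst 0) = 0%E.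
Proof.
move=> oO p0 q0 vp0 r0; rewrite /functional W_norm0// !Ls_norm_cst0// !poweR0r//.
by rewrite !mule0 adde0 subee.
Qed.

(** On the concentric cube of half the size every factor of the bump has an
    argument at least 1/2, independently of e. *)
Lemma bump_lower_bound (c : E) e x : 0 < e ->
  box (c - const_mx (e / 2)) (c + const_mx (e / 2)) x ->
  (flat 1 (2^-1 : R) * flat 1 2^-1) ^+ N <=
    bump (c - const_mx e) (c + const_mx e) e^-1 x.
Proof.
move=> e0 H; rewrite -[X in _ ^+ X]card_ord -prodr_const.
apply: ler_prod => i _; rewrite mulr_ge0 ?flat1_ge0//=.
have := H i; rewrite !mxE => /andP[h1 h2].
by apply: ler_pM; rewrite ?flat1_ge0//; apply: flat1_mono;
  rewrite ler_pdivlMl//; lra.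
Qed.

Section bubble.
Variables (Omega : set E) (c : E) (M e : R).
Hypotheses (oO : open Omega) (e0 : 0 < e) (M0 : 0 < M)
  (cO : cbox (c - const_mx e) (c + const_mx e) `<=` Omega).
Let mO := open_measurable_rV oO.

Definition bubble x : R := M * bump (c - const_mx e) (c + const_mx e) e^-1 x.

Lemma test_function_bubble : test_function Omega bubble.
Proof.
apply: (@test_function_bump _ _ _ _ _ _ _ (c - const_mx e) (c + const_mx e)) => //.
  by rewrite invr_gt0.
exact: subset_box_cbox.
Qed.

Lemma bubble_ge0 x : 0 <= bubble x.
Proof. by rewrite mulr_ge0 ?bump_ge0// ltW. Qed.

Lemma bubble_le x : `|bubble x| <= M.
Proof. by rewrite ger0_norm ?bubble_ge0// ger_pMr ?bump_le1. Qed.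

Let B := box (c - const_mx (2 * e)) (c + const_mx (2 * e)).

Let cB : cbox (c - const_mx e) (c + const_mx e) `<=` B.
Proof.
have e0' := e0; move=> x H i; have := H i; rewrite !mxE => /andP[h1 h2].
by apply/andP; split; lra.
Qed.

Let bubble_out x : ~ cbox (c - const_mx e) (c + const_mx e) x -> bubble x = 0.
Proof.
move=> H; rewrite /bubble bump_supp ?mulr0 ?invr_gt0//.
by move=> /subset_box_cbox.
Qed.

Lemma bubble_partial_le i x : `|partial i bubble x| <= M * (e^-1 * 4 * N%:R).
Proof.
have Cb := Ck_bump 1 (c - const_mx e) (c + const_mx e) e^-1.
have db : derivable (bump (c - const_mx e) (c + const_mx e) e^-1) x (delta_mx ord0 i).
  by have [_ /(_ i) []] := Cb.
have -> : partial i bubble x = M * partial i (bump (c - const_mx e) (c + const_mx e) e^-1) x.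
  rewrite (_ : bubble = cst M \* bump (c - const_mx e) (c + const_mx e) e^-1)//.
  by rewrite partialM// partial_cst mulr0 addr0.
rewrite normrM gtr0_norm// ler_wpM2l ?(ltW M0)//.
by rewrite (le_trans (partial_bump _ _ _ _ _))// gtr0_norm ?invr_gt0.
Qed.

Lemma bubble_partial_out i x : ~ B x -> partial i bubble x = 0.
Proof.
move=> xB; apply: (@partial_eq0_off_closed _ _ (cbox (c - const_mx e) (c + const_mx e))).
- exact: closed_cbox.
- exact: bubble_out.
- by move=> /cB.
Qed.

Let mbubble : measurable_fun Omega bubble.
Proof.
apply: measurable_funTS; apply: continuous_measurable_rV.
by have [] := test_function_C1 test_function_bubble.
Qed.

(** The cube of half-side 2 e, whose open box has a known volume, is used to
    contain the closed cube of half-side e. *)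
Lemma bubble_powR_le q : 0 < q ->
  (Ls_norm Omega q%:E bubble `^ q <= (M `^ q * (2 * (2 * e)) ^+ N)%:E)%E.
Proof.
have e0' := e0; move=> q0; rewrite Ls_norm_pow ?gt_eqF//.
rewrite EFinM -(@lebesgue_cube _ _ c); last by lra.
apply: integral_powR_le => //.
- exact: measurable_box.
- exact: ltW.
- by move=> x _; exact: bubble_le.
- by move=> x _ xB; apply: bubble_out => /cB.
Qed.

Lemma bubble_powR_ge q : 0 < q ->
  (((M * (flat 1 (2^-1 : R) * flat 1 2^-1) ^+ N) `^ q * e ^+ N)%:E <=
     Ls_norm Omega q%:E bubble `^ q)%E.
Proof.
have e0' := e0; move=> q0; rewrite Ls_norm_pow ?gt_eqF//.
pose B' := box (c - const_mx (e / 2)) (c + const_mx (e / 2)).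
have mB' : measurable B' by exact: measurable_box.
have B'O : B' `<=` Omega.
  apply: subset_trans cO => x H i; have := H i; rewrite !mxE => /andP[h1 h2].
  by apply/andP; split; lra.
have mpow := measurable_normr_powR q mbubble.
apply: (@le_trans _ _ (\int[mu]_(x in B') (`|bubble x| `^ q)%:E)%E); last first.
  by apply: ge0_subset_integral => // x _; rewrite lee_fin powR_ge0.
have -> : e ^+ N = (2 * (e / 2)) ^+ N by congr (_ ^+ _); field.
rewrite EFinM -(@lebesgue_cube _ _ c); last by lra.
rewrite -/B' -integral_cst//; apply: ge0_le_integral => //.
- by move=> x _; rewrite lee_fin powR_ge0.
- by apply: measurable_funS mpow.
- move=> x Bx; rewrite lee_fin ge0_ler_powR ?nnegrE ?(ltW q0)//.
    by rewrite mulr_ge0 ?(ltW M0)// exprn_ge0// mulr_ge0 ?flat1_ge0.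
  by rewrite ger0_norm ?bubble_ge0// ler_wpM2l ?(ltW M0)// bump_lower_bound.
Qed.

(** The gradient is of size M / e on a cube of size e, so the norm is of order
    M e^(N/p - 1). *)
Lemma bubble_W_norm_le p : 0 < p ->
  (W_norm Omega p bubble <=
    (N%:R * (M * (e^-1 * 4 * N%:R)) * (2 * (2 * e)) `^ (N%:R / p))%:E)%E.
Proof.
have e0' := e0; move=> p0; rewrite W_norm_test ?gt_eqF//; last exact: test_function_bubble.
rewrite Ls_normE ?gt_eqF//; set L := N%:R * _.
have L0 : 0 <= L.
  by rewrite !mulr_ge0// ?(ltW M0)// invr_ge0 ltW.
have [_ _ cd] := test_function_C1 test_function_bubble.
have mg : measurable_fun Omega (fun x => euclidean_norm (gradient bubble x)).
  apply: measurable_euclidean_norm => i; under eq_fun do rewrite mxE.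
  by apply: measurable_funTS; exact: continuous_measurable_rV.
have le1 : (\int[mu]_(x in Omega) (`|euclidean_norm (gradient bubble x)| `^ p)%:E <=
    (L `^ p * (2 * (2 * e)) ^+ N)%:E)%E.
  rewrite EFinM -(@lebesgue_cube _ _ c); last by lra.
  apply: integral_powR_le => //.
  - exact: measurable_box.
  - move=> x _; rewrite ger0_norm ?sqrtr_ge0//; apply: euclidean_norm_le => [|i].
      by rewrite !mulr_ge0// ?(ltW M0)// invr_ge0 ltW.
    by rewrite mxE bubble_partial_le.
  - move=> x _ xB; rewrite /euclidean_norm big1 ?sqrtr0// => i _.
    by rewrite mxE bubble_partial_out// expr0n.
have ie0 : (0 <= \int[mu]_(x in Omega) (`|euclidean_norm (gradient bubble x)| `^ p)%:E)%E.
  by apply: integral_ge0 => x _; rewrite lee_fin powR_ge0.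
have e40 : 0 <= 2 * (2 * e) by lra.
rewrite (_ : L * _ = (L `^ p * (2 * (2 * e)) ^+ N) `^ p^-1).
  apply: (gt0_ler_poweR _ _ _ le1).
  - by rewrite invr_ge0 ltW.
  - by rewrite in_itv/= ie0 leey.
  - by rewrite in_itv/= leey andbT lee_fin mulr_ge0 ?powR_ge0// exprn_ge0.
rewrite [in RHS]powRM ?powR_ge0 ?exprn_ge0// -powR_mulrn// -!powRrM mulfV ?gt_eqF//.
by rewrite powRr1.
Qed.

End bubble.

(** Take a bump of height M on a cube of half-side e.  The two lower-order terms
    are both of order e^N, and varpi > q makes the subtracted one win once M is
    large.  With M fixed, the leading term is of order e^((N/p - 1) r), which is
    negligible against e^N because r > p N / (N - p); the Sobolev norm tends to 0
    with e. *)
Lemma exists_negative_bubble Omega p q varpi r lambda rho :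
  open Omega -> Omega !=set0 -> 1 < p -> p < N%:R -> p * N%:R / (N%:R - p) < r ->
  0 < q -> q < varpi -> 0 < lambda -> 0 < rho ->
  exists u, [/\ test_function Omega u, forall x, 0 <= u x,
    (W_norm Omega p u < rho%:E)%E & (functional Omega p q varpi r lambda u < 0)%E].
Proof.
move=> oO [c Oc] p1 pN pr q0 qvp l0 rho0.
have p0 : 0 < p := lt_trans ltr01 p1.
have vp0 : 0 < varpi := lt_trans q0 qvp.
have N0 : 0 < N%:R :> R := lt_trans p0 pN.
have Np0 : 0 < N%:R - p by rewrite subr_gt0.
have r0 : 0 < r by apply: le_lt_trans pr; rewrite divr_ge0 ?mulr_ge0 ?ltW.
have [e1 /= e10 e1O] := (nbhs_ballP _ _).1 (open_nbhs_nbhs (conj oO Oc)).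
set m := (flat 1 (2^-1 : R) * flat 1 2^-1) ^+ N.
have m0 : 0 < m by rewrite exprn_gt0// mulr_gt0 ?flat1_gt0 ?invr_gt0.
(* This M makes the upper bound for the L^q term half of the lower bound for the
   L^varpi term; the factor 4 ^+ N compares the volumes of the two cubes. *)
have [||M M0 ME] := @powR_solve _ (varpi - q) (2 * 4 ^+ N * varpi / (q * lambda * m `^ varpi)).
- by rewrite subr_gt0.
- by rewrite divr_gt0 ?mulr_gt0 ?exprn_gt0 ?powR_gt0.
pose B := lambda / varpi * (M * m) `^ varpi.
have B0 : 0 < B by rewrite mulr_gt0 ?divr_gt0 ?powR_gt0 ?mulr_gt0.
have BE : q^-1 * (M `^ q * 4 ^+ N) = B / 2.
  rewrite /B powRM ?(ltW M0) ?(ltW m0)//.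
  have -> : M `^ varpi = M `^ (varpi - q) * M `^ q.
    by rewrite -powRD ?gt_eqF ?implybT// subrK.
  rewrite ME; field.
  by rewrite !gt_eqF ?powR_gt0.
pose s := N%:R / p - 1.
have s0 : 0 < s by rewrite subr_gt0 ltr_pdivlMr// mul1r.
have sr : 0 < s * r - N%:R.
  rewrite subr_gt0 -ltr_pdivrMl// (le_lt_trans _ pr)// le_eqVlt.
  by apply/orP; left; apply/eqP; rewrite /s; field; rewrite !gt_eqF.
pose D := N%:R * (4 * N%:R) * 4 `^ (N%:R / p) * M.
have D0 : 0 < D by rewrite /D !mulr_gt0 ?powR_gt0.
(* For e < d1 the Sobolev norm is less than rho; for e < d2 the leading term is
   less than half of the lower bound for the L^varpi term. *)
have [d1 d10 d1P] := powR_small s0 (divr_gt0 rho0 D0).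
have T0 : 0 < B * r / (2 * D `^ r) by apply: divr_gt0; apply: mulr_gt0 => //; exact: powR_gt0.
have [d2 d20 d2P] := powR_small sr T0.
pose e := Num.min e1 (Num.min d1 d2) / 2.
have mn0 : 0 < Num.min e1 (Num.min d1 d2) by rewrite !lt_min e10 d10 d20.
have e0 : 0 < e by rewrite divr_gt0.
have : e < Num.min e1 (Num.min d1 d2) by rewrite ltr_pdivrMr// ltr_pMr// ltr1n.
rewrite !lt_min => /andP[ee1 /andP[ed1 ed2]].
have cO : cbox (c - const_mx e) (c + const_mx e) `<=` Omega.
  apply: subset_trans e1O; rewrite ball_rV// => x H i; have := H i; rewrite !mxE.
  by move=> /andP[h1 h2]; apply/andP; split; lra.
have KE : N%:R * (M * (e^-1 * 4 * N%:R)) * (2 * (2 * e)) `^ (N%:R / p) = D * e `^ s.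
  have -> : 2 * (2 * e) = 4 * e by ring.
  rewrite powRM ?(ltW e0)// (_ : e `^ (N%:R / p) = e * e `^ s).
    by rewrite /D; field; rewrite gt_eqF.
  rewrite -[X in _ = X * _](powRr1 (ltW e0)) -powRD ?(gt_eqF e0) ?implybT//.
  by rewrite /s addrC subrK.
have WK := bubble_W_norm_le oO e0 M0 cO p0; rewrite {}KE in WK.
exists (bubble c M e); split.
- exact: test_function_bubble.
- exact: bubble_ge0.
- by apply: (le_lt_trans WK); rewrite lte_fin mulrC -ltr_pdivlMr// d1P.
have W0 : (0 <= W_norm Omega p (bubble c M e))%E by exact: Lnorm_ge0.
have WKr : (W_norm Omega p (bubble c M e) `^ r <= ((D * e `^ s) `^ r)%:E)%E.
  apply: (gt0_ler_poweR _ _ _ WK); first exact: ltW.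
  - by rewrite in_itv/= W0 leey.
  - by rewrite in_itv/= leey andbT lee_fin mulr_ge0 ?powR_ge0// ltW.
have Q := bubble_powR_le oO e0 M0 cO q0.
have V := bubble_powR_ge oO e0 M0 cO vp0; rewrite -/m in V.
apply: (@le_lt_trans _ _ (r^-1 * (D * e `^ s) `^ r +
   q^-1 * (M `^ q * (2 * (2 * e)) ^+ N) - lambda / varpi * ((M * m) `^ varpi * e ^+ N))%:E).
  rewrite EFinB EFinD (EFinM r^-1) (EFinM q^-1) (EFinM (lambda / varpi)).
  apply: leeB; first apply: leeD.
  - by rewrite lee_pmul2l// lte_fin invr_gt0.
  - by rewrite lee_pmul2l// lte_fin invr_gt0.
  - by rewrite lee_pmul2l// lte_fin divr_gt0.
rewrite lte_fin subr_lt0.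
have -> : 2 * (2 * e) = 4 * e by ring.
rewrite exprMn (mulrA (M `^ q)) (mulrA q^-1) BE mulrA -/B -ltrBrDr -mulrBl.
have -> : B - B / 2 = B / 2 by field.
rewrite powRM ?powR_ge0 ?(ltW D0)// -powRrM.
have -> : e `^ (s * r) = e `^ (s * r - N%:R) * e ^+ N.
  by rewrite -(powR_mulrn _ (ltW e0)) -powRD ?(gt_eqF e0) ?implybT// subrK.
rewrite !mulrA ltr_pM2r ?exprn_gt0// -ltr_pdivlMl; last first.
  by rewrite mulr_gt0 ?invr_gt0 ?powR_gt0.
apply: lt_le_trans (d2P _ e0 ed2) _; rewrite le_eqVlt; apply/orP; left; apply/eqP.
by field; rewrite !gt_eqF ?powR_gt0.
Qed.

End main.

Unset Implicit Arguments.

Theorem corollary2p3 (R : realType) (N : nat) (Omega : set 'rV[R]_N)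
    (p q varpi r lambda : R) :
  1 < p -> p < N%:R -> bounded_domain Omega ->
  let pstar := p * N%:R / (N%:R - p) in
  pstar < r -> varpi <= pstar -> q < varpi -> 1 <= q -> 0 < lambda ->
  let J := functional Omega p q varpi r lambda in
  let Jpos := functional_pos Omega p q varpi r lambda in
  [/\ local_min_Linfty Omega p J, local_min_C1 Omega p J &
      ~ local_min_W1p0 Omega p J] /\
  [/\ local_min_Linfty Omega p Jpos, local_min_C1 Omega p Jpos &
      ~ local_min_W1p0 Omega p Jpos].
Proof.
move=> p1 pN [nO oO _ bO] pstar pr vpp qvp q1 l0 J Jpos.
have p0 : 0 < p := lt_trans ltr01 p1.
have q0 : 0 < q := lt_le_trans ltr01 q1.
have vp0 : 0 < varpi := lt_trans q0 qvp.
have N0 : 0 < N%:R :> R := lt_trans p0 pN.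
have r0 : 0 < r by apply: le_lt_trans pr; rewrite divr_ge0 ?mulr_ge0 ?subr_ge0 ?ltW.
have mO := open_measurable_rV oO.
have Ooo : (lebesgue_rV R N Omega < +oo)%E.
  have [M M0 OM] := bounded_sub_cbox bO.
  apply: le_lt_trans (lebesgue_cbox_lty (const_mx (- M)) (const_mx M)).
  by apply: le_measure => //; rewrite inE//; exact: measurable_cbox.
have J0 : J (cst 0) = 0%E by apply: functional_cst0; rewrite ?gt_eqF.
have Jpos_ge0 u : (forall x, 0 <= u x) -> Jpos u = J u.
  move=> u0; rewrite /Jpos /J /functional_pos /functional.
  have -> // : u^\+ = u by apply/funext => x; exact/max_idPl.
have Jpos0 : Jpos (cst 0) = 0%E by rewrite Jpos_ge0.
have vq0 : 0 < varpi - q by rewrite subr_gt0.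
have [|rho rho0 rhoE] := @powR_solve R (varpi - q) (varpi / (lambda * q)) vq0.
  by rewrite divr_gt0 ?mulr_gt0.
have Jge u : W1p0 Omega p u ->
    {ae lebesgue_rV R N, forall x, Omega x -> `|u x| <= rho} ->
    (0 <= J u)%E /\ (0 <= Jpos u)%E.
  move=> [[_ [[mu _] _ _] _] _] urho.
  have W0 : (0 <= (r^-1)%:E * W_norm Omega p u `^ r)%E.
    by rewrite mule_ge0 ?poweR_ge0// lee_fin invr_ge0 ltW.
  split; apply: (lower_order_dominates _ _ _ _ _ rho0 rhoE) => //.
    exact: measurable_funrpos.
  apply: filterS urho => x H /H; apply: le_trans.
  rewrite ger0_norm ?funrpos_ge0// /funrpos.
  by rewrite ge_max ler_norm normr_ge0.
have Linf u : W1p0 Omega p u -> (Ls_norm Omega +oo u < rho%:E)%E ->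
    (0 <= J u)%E /\ (0 <= Jpos u)%E.
  by move=> Wu urho; apply: Jge => //; exact: Linfty_norm_ae.
have C1 u : W1p0 Omega p u -> (C1_norm Omega u < rho%:E)%E ->
    (0 <= J u)%E /\ (0 <= Jpos u)%E.
  by move=> Wu urho; apply: Jge => //; apply: nearW => x; exact: C1_norm_bound.
have neg d : 0 < d -> exists u, [/\ W1p0 Omega p u, (W_norm Omega p u < d%:E)%E,
    (J u < 0)%E & (Jpos u < 0)%E].
  move=> d0.
  have [u [tu u0 uW uJ]] := exists_negative_bubble oO nO p1 pN pr q0 qvp l0 d0.
  by exists u; split; [exact: test_function_W1p0| | |rewrite Jpos_ge0].
split; split.
- by exists rho => // u Wu _ /(Linf _ Wu) [h _]; rewrite J0.
- by exists rho => // u Wu _ /(C1 _ Wu) [h _]; rewrite J0.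
- move=> [d d0 H]; have [u [Wu uW uJ _]] := neg d d0.
  by have := H u Wu Wu uW; rewrite J0 leNgt uJ.
- by exists rho => // u Wu _ /(Linf _ Wu) [_ h]; rewrite Jpos0.
- by exists rho => // u Wu _ /(C1 _ Wu) [_ h]; rewrite Jpos0.
- move=> [d d0 H]; have [u [Wu uW _ uJ]] := neg d d0.
  by have := H u Wu Wu uW; rewrite Jpos0 leNgt uJ.
Qed.
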